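(* For a partition $\lambda$, $$\Delta(\tilde s_\lambda)=\sum_{\alpha:\,|\alpha|\le|\lambda|}\ \sum_{\gamma\vdash|\lambda|-|\alpha|}\ \sum_{\beta}c^\lambda_{\alpha\gamma}\,\tilde s_\alpha\otimes\tilde s_\beta,$$ where $c^\lambda_{\alpha\gamma}$ are the Littlewood–Richardson coefficients and the inner sum is over partitions $\beta$ such that $\gamma/\beta$ is a horizontal strip. In particular, for partitions $\alpha,\beta$, the coefficient of $\tilde s_\alpha\otimes\tilde s_\beta$ in $\Delta(\tilde s_\lambda)$ equals $\sum_\gamma c^\lambda_{\alpha\gamma}$, the sum over all partitions $\gamma$ such that $\gamma/\beta$ is a horizontal strip of size $|\lambda|-|\alpha|-|\beta|$.
   Context: $Sym=\mathbb{Q}[p_1,p_2,\ldots]$ with Hall inner product $\langle p_\lambda,p_\mu\rangle=z_\lambda\delta_{\lambda\mu}$, $z_\lambda=\prod_im_i(\lambda)!i^{m_i(\lambda)}$ ($m_i(\lambda)$ = number of parts equal to $i$); $s_\lambda$ are Schur functions and $\chi^\lambda(\gamma)=\langle s_\lambda,p_\gamma\rangle$. The coproduct $\Delta:Sym\to Sym\otimes Sym$ is the algebra homomorphism with $\Delta(p_k)=p_k\otimes1+1\otimes p_k$. For $i\ge1$ let $q_i=\frac1i\sum_{d\mid i}\mathrm{mob}(i/d)p_d$ ($\mathrm{mob}$ the Möbius function), $(x)_r$ the falling factorial, $\overline{\mathbf{p}}_{i^r}=i^r(q_i)_r$ for $r\ge1$, $\overline{\mathbf{p}}_{i^0}=1$,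 $\mathbf{p}_{i^r}=\sum_{k=0}^r(-1)^{r-k}\binom rk\overline{\mathbf{p}}_{i^k}$, $\mathbf{p}_\gamma=\prod_i\mathbf{p}_{i^{m_i(\gamma)}}$. The irreducible character basis is $\tilde s_\lambda=\sum_{\gamma\vdash|\lambda|}\chi^\lambda(\gamma)\mathbf{p}_\gamma/z_\gamma$ (a basis of $Sym$). A skew shape $\gamma/\beta$ (with $\beta\subseteq\gamma$) is a horizontal strip if it has at most one cell in each column. *)

(* Defs.v *)
From HB Require Import structures.
From mathcomp Require Import all_boot all_order all_algebra finmap.
From mathcomp.multinomials Require Import monalg.

Set Implicit Arguments.
Unset Strict Implicit.
Unset Printing Implicit Defensive.

Import GRing.Theory.
Local Open Scope ring_scope.

Definition is_intpartn (s : seq nat) : bool := sorted geq s && (0%N \notin s).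

Record intpartn : Type := IntPartn { intpartn_seq :> seq nat; _ : is_intpartn intpartn_seq }.

HB.instance Definition _ := [isSub for intpartn_seq].
HB.instance Definition _ := [Countable of intpartn by <:].

Definition psize (la : intpartn) : nat := sumn la.

(* [part la i] is the part of index [i], counted from 0, and 0 beyond the
   length of [la]. *)
Definition part (la : intpartn) (i : nat) : nat := nth 0%N la i.

Definition mult (la : intpartn) (i : nat) : nat := count_mem i la.

(* A partition of size at most [n] has at most [n] parts, all at most [n]. *)
Definition intpartns_le (n : nat) : seq intpartn :=
  [seq la <- pmap insub [seq map val (bseqval t) | t : {bseq n of 'I_n.+1}]
         | (psize la <= n)%N].

Definition intpartns (n : nat) : seq intpartn :=
  [seq la <- intpartns_le n | psize la == n].

Lemma size_partn_le (s : seq nat) : 0%N \notin s -> (size s <= sumn s)%N.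
Proof.
elim: s => //= x s IHs; rewrite inE negb_or eq_sym -lt0n => /andP[x0 /IHs].
by rewrite -add1n; apply: leq_add.
Qed.

Lemma mem_sumn_le (s : seq nat) x : x \in s -> (x <= sumn s)%N.
Proof.
elim: s => //= y s IHs; rewrite inE => /predU1P[->|/IHs xs].
  exact: leq_addr.
exact: leq_trans xs (leq_addl _ _).
Qed.

Lemma mem_intpartns_le n la : (la \in intpartns_le n) = (psize la <= n)%N.
Proof.
rewrite mem_filter andb_idr // => len.
rewrite mem_pmap_sub /=; case: la len => s /= sP; rewrite /psize /= => len.
have /andP[_ s0] := sP.
have szs : (size (map (@inord n) s) <= n)%N.
  by rewrite size_map (leq_trans (size_partn_le s0)).
apply/imageP; exists (Bseq szs) => //=.
rewrite -map_comp -[LHS]map_id; apply/eq_in_map => x xs /=.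
by rewrite inordK // ltnS (leq_trans (mem_sumn_le xs)).
Qed.

Lemma uniq_intpartns_le n : uniq (intpartns_le n).
Proof.
apply/filter_uniq/pmap_sub_uniq; rewrite map_inj_uniq ?enum_uniq // => t u.
by move/(inj_map val_inj)/val_inj.
Qed.

Lemma mem_intpartns n la : (la \in intpartns n) = (psize la == n).
Proof.
by rewrite mem_filter mem_intpartns_le; case: eqP => // ->; rewrite leqnn.
Qed.

Lemma uniq_intpartns n : uniq (intpartns n).
Proof. exact/filter_uniq/uniq_intpartns_le. Qed.

(* [skew_cell ga be i j]: the cell in row [i] and column [j] (counted from 0)
   belongs to the diagram of [ga] but not to that of [be]. *)
Definition skew_cell (ga be : intpartn) (i j : nat) : bool :=
  (part be i <= j < part ga i)%N.

Definition part_sub (be ga : intpartn) : bool :=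
  [forall i : 'I_(size be), (part be i <= part ga i)%N].

(* [ga/be] is a horizontal strip; the columns of [ga] are the [j < part ga 0] *)
Definition hstrip (ga be : intpartn) : bool :=
  part_sub be ga &&
  [forall j : 'I_(part ga 0),
     (#|[set i : 'I_(size ga) | skew_cell ga be i j]| <= 1)%N].

(* Indices [i] that are not parts of [la] contribute a factor 1. *)
Definition zee (la : intpartn) : nat :=
  \prod_(i <- undup la) ((mult la i)`! * i ^ mult la i).

(* The polynomial variable of index [i : nat] is the power sum p_(i+1).
   The [Eval] only removes elaboration artifacts ([reverse_coercion]) on which
   unification of canonical structures diverges. *)
Definition Mon := Eval cbv beta delta [reverse_coercion] in {cmonom nat}.
Definition Sym := Eval cbv beta delta [reverse_coercion] in {malg rat[{cmonom nat}]}.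

(* p_k, for [0 < k] *)
Definition psum (k : nat) : Sym := << ucm k.-1 >>.

Definition psump (la : intpartn) : Sym := \prod_(i <- la) psum i.

(* z_la for the monomial p_la: the exponent of p_(i+1) is mult la (i+1). *)
Definition zmon (m : Mon) : nat :=
  \prod_(i <- finsupp m) ((m i)`! * i.+1 ^ m i).

(* The power-sum products are the monomials, so this is the bilinear form with
   <p_la, p_mu> = z_la delta_(la, mu); see [hall_psump]. *)
Definition hall (f g : Sym) : rat :=
  \sum_(m <- msupp f) f@_m * g@_m * (zmon m)%:R.

(* the complete homogeneous symmetric function h_n *)
Definition hsym (n : nat) : Sym :=
  \sum_(mu <- intpartns n) (zee mu)%:R^-1 *: psump mu.

(* Jacobi-Trudi: s_la = det (h_(la_i - i + j)), with h_k = 0 for k < 0. *)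
Definition schur (la : intpartn) : Sym :=
  \det (\matrix_(i < size la, j < size la)
          if (i <= part la i + j)%N then hsym (part la i + j - i) else 0).

Definition chi (la ga : intpartn) : rat := hall (schur la) (psump ga).

(* The Littlewood-Richardson coefficient c^la_(al, ga): the Schur functions are
   orthonormal, so this is the coefficient of s_la in s_al s_ga. *)
Definition LRcoef (la al ga : intpartn) : rat := hall (schur al * schur ga) (schur la).

(* The Moebius function, for [0 < n] *)
Definition mob (n : nat) : rat :=
  if all (fun p => logn p n == 1%N) (primes n) then (-1) ^+ size (primes n)
  else 0.

Definition qsym (i : nat) : Sym :=
  i%:R^-1 *: \sum_(d <- divisors i) mob (i %/ d) *: psum d.

Definition falling (R : pzRingType) (x : R) (r : nat) : R :=
  \prod_(j < r) (x - j%:R).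

(* \overline{p}_(i^r) and p_(i^r), of which [ptilp ga] is the product p_ga *)
Definition pbar (i r : nat) : Sym := (i ^ r)%:R * falling (qsym i) r.

Definition ptil (i r : nat) : Sym :=
  \sum_(k < r.+1) (-1) ^+ (r - k) * 'C(r, k)%:R * pbar i k.

(* [ptil i 0 = 1], so only the parts of [ga] contribute. *)
Definition ptilp (ga : intpartn) : Sym :=
  \prod_(i <- undup ga) ptil i (mult ga i).

Definition stil (la : intpartn) : Sym :=
  \sum_(ga <- intpartns (psize la)) (chi la ga / (zee ga)%:R) *: ptilp ga.

Section ProdMonom.
Variables (M N : conomType).
Implicit Types x y z : M * N.

Definition pm_one : M * N := (mone, mone).
Definition pm_mul x y : M * N := (mmul x.1 y.1, mmul x.2 y.2).

Lemma pm_mulA : associative pm_mul.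
Proof. by move=> x y z; rewrite /pm_mul /= !mulmA. Qed.
Lemma pm_mul1m : left_id pm_one pm_mul.
Proof. by case=> a b; rewrite /pm_mul /= !mul1m. Qed.
Lemma pm_mulm1 : right_id pm_one pm_mul.
Proof. by case=> a b; rewrite /pm_mul /= !mulm1. Qed.
Lemma pm_unitm x y : pm_mul x y = pm_one -> x = pm_one /\ y = pm_one.
Proof.
by case: x y => [a b] [c d] [] /unitm[/= -> ->] /unitm[/= -> ->].
Qed.
Lemma pm_mulC : commutative pm_mul.
Proof.
by move=> [a b] [c d]; rewrite /pm_mul /= (mulmC a) (mulmC b).
Qed.

HB.instance Definition _ := Choice_isMonomialDef.Build (M * N)%type
  pm_mulA pm_mul1m pm_mulm1 pm_unitm.
HB.instance Definition _ := MonomialDef_isConomialDef.Build (M * N)%type pm_mulC.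
End ProdMonom.

Section Tensor.
Variables (R : comNzRingType) (M N : conomType).
Implicit Types (f : {malg R[M]}) (g : {malg R[N]}).

Definition tensor f g : {malg R[(M * N)%type]} :=
  \sum_(m <- msupp f) \sum_(n <- msupp g) << f@_m * g@_n *g (m, n) >>.

Lemma tensorE f g m n : (tensor f g)@_(m, n) = f@_m * g@_n.
Proof.
rewrite [in RHS](monalgE f) [in RHS](monalgE g) !raddf_sum /= mulr_suml.
apply: eq_bigr => a _; rewrite raddf_sum mulr_sumr; apply: eq_bigr => b _.
rewrite /= !mcoeffU xpair_eqE; case: eqP => _ /=; last by rewrite mulr0n mul0r.
by case: eqP => _ /=; rewrite ?mulr0n ?mulr0.
Qed.

Lemma tensor_linearl (a : R) f f' g :
  tensor (a *: f + f') g = a *: tensor f g + tensor f' g.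
Proof.
apply/malgP => -[m n].
by rewrite mcoeffD mcoeffZ !tensorE mcoeffD mcoeffZ mulrDl mulrA.
Qed.

Lemma tensor_linearr (a : R) f g g' :
  tensor f (a *: g + g') = a *: tensor f g + tensor f g'.
Proof.
apply/malgP => -[m n].
by rewrite mcoeffD mcoeffZ !tensorE mcoeffD mcoeffZ mulrDr mulrCA.
Qed.

Lemma tensorU (a b : R) m n :
  tensor << a *g m >> << b *g n >> = << a * b *g (m, n) >>.
Proof.
apply/malgP => -[k l]; rewrite tensorE !mcoeffU xpair_eqE.
by case: eqP => _ /=; [case: eqP => _ /=|]; rewrite ?mulr0n ?mulr0 ?mul0r.
Qed.

Lemma tensor11 : tensor 1 1 = 1.
Proof. by rewrite tensorU mulr1. Qed.

Lemma tensor_suml I (r : seq I) F g :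
  tensor (\sum_(i <- r) F i) g = \sum_(i <- r) tensor (F i) g.
Proof.
apply/malgP => -[m n]; rewrite tensorE !raddf_sum mulr_suml.
by apply: eq_bigr => i _; rewrite /= tensorE.
Qed.

Lemma tensor_sumr I (r : seq I) f G :
  tensor f (\sum_(i <- r) G i) = \sum_(i <- r) tensor f (G i).
Proof.
apply/malgP => -[m n]; rewrite tensorE !raddf_sum mulr_sumr.
by apply: eq_bigr => i _; rewrite /= tensorE.
Qed.

Lemma malgUM (K : monomType) (a b : R) (m n : K) :
  << a *g m >> * << b *g n >> = << a * b *g mmul m n >>.
Proof. by rewrite malgM_def fgmulUU. Qed.

Lemma tensorM f g f' g' :
  tensor f g * tensor f' g' = tensor (f * f') (g * g').
Proof.
have e2 x y : tensor x y = \sum_(m <- msupp x) \sum_(n <- msupp y)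
    tensor << x@_m *g m >> << y@_n *g n >>.
  rewrite {1}(monalgE x) tensor_suml; apply: eq_bigr => m _.
  by rewrite {1}(monalgE y) tensor_sumr.
rewrite (e2 f g) (e2 f' g') (malgME f f') (malgME g g').
rewrite mulr_suml tensor_suml; apply: eq_bigr => m _.
rewrite mulr_suml [RHS]tensor_suml.
under eq_bigr => n _ do rewrite mulr_sumr.
rewrite exchange_big /=; apply: eq_bigr => k _.
rewrite tensor_sumr; apply: eq_bigr => n _.
rewrite mulr_sumr tensor_sumr; apply: eq_bigr => l _.
by rewrite !tensorU malgUM mulrACA.
Qed.

End Tensor.

(* Sym (x) Sym has the products m (x) n of two monomials as a Q-basis. *)
Definition Sym2 := Eval cbv beta delta [reverse_coercion] in
  {malg rat[({cmonom nat} * {cmonom nat})%type]}.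

Definition tens : Sym -> Sym -> Sym2 := @tensor rat Mon Mon.

Notation "f ⊗ g" := (tens f g) (at level 40, left associativity) : ring_scope.

Definition Delta_mon (m : Mon) : Sym2 :=
  \prod_(i <- finsupp m) (psum i.+1 ⊗ 1 + 1 ⊗ psum i.+1) ^+ m i.

Definition Delta : Sym -> Sym2 := mmap malgC Delta_mon.

(* finitely supported families of coefficients *)
Definition coefs2 := Eval cbv beta delta [reverse_coercion] in
  {malg rat[(intpartn * intpartn)%type]}.

Definition stil2_comb (C : coefs2) : Sym2 :=
  \sum_(ab <- msupp C) C@_ab *: (stil ab.1 ⊗ stil ab.2).

(* [x] has an expansion, and the coefficient of [stil al ⊗ stil be] in every
   expansion of [x] is [c]. *)
Definition stil2_coef_is (x : Sym2) (al be : intpartn) (c : rat) : Prop :=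
  (exists C : coefs2, stil2_comb C = x) /\
  (forall C : coefs2, stil2_comb C = x -> C@_(al, be) = c).

Lemma hallEw (d : {fset Mon}) f g : (msupp f `<=` d)%fset ->
  hall f g = \sum_(m <- d) f@_m * g@_m * (zmon m)%:R.
Proof.
move=> fd; rewrite /hall (big_fset_incl _ fd) // => m _ /mcoeff_outdom ->.
by rewrite !mul0r.
Qed.

Lemma hallC f g : hall f g = hall g f.
Proof.
rewrite (hallEw _ (fsubsetUl (msupp f) (msupp g))).
rewrite (hallEw _ (fsubsetUr (msupp f) (msupp g))).
by apply: eq_bigr => m _; rewrite [f@_m * _]mulrC.
Qed.

Lemma hall_linear f (a : rat) g h : hall f (a *: g + h) = a * hall f g + hall f h.
Proof.
rewrite /hall mulr_sumr -big_split; apply: eq_bigr => m _ /=.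
by rewrite mcoeffD mcoeffZ mulrDr mulrDl mulrCA !mulrA.
Qed.

Definition monp (la : intpartn) : Mon :=
  \big[mmul/mone]_(i <- (la : seq nat)) ucm i.-1.

Lemma monpE la i : monp la i = mult la i.+1.
Proof.
rewrite /monp /mult; case: la => s /= /andP[_]; elim: s => [_|x s IHs] /=.
  by rewrite big_nil cm1.
rewrite inE negb_or big_cons cmM cmU => /andP[x0 /IHs ->]; congr (_ + _)%N.
by case: x x0.
Qed.

Lemma psumpE la : psump la = << monp la >>.
Proof.
rewrite /psump /monp; elim: (la : seq nat) => [|x s IHs].
  by rewrite !big_nil.
rewrite [LHS]big_cons [in RHS]big_cons IHs malgUM {IHs}.
by rewrite [X in mkmalgU _ X]mulr1.
Qed.

Lemma monp_inj : injective monp.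
Proof.
move=> la mu eqm; apply/val_inj/(sorted_eq (leT := geq)) => /=.
- by move=> x y z /= h1 h2; apply: leq_trans h2 h1.
- by move=> x y /=; rewrite andbC => /anti_leq.
- by case: la {eqm} => s /= /andP[].
- by case: mu {eqm} => s /= /andP[].
apply/allP => -[|i] _ /=.
  case: la mu {eqm} => s /= /andP[_ s0] [t] /= /andP[_ t0].
  by rewrite (count_memPn s0) (count_memPn t0).
by rewrite -/(mult la i.+1) -/(mult mu i.+1) -!monpE eqm.
Qed.

Lemma zmon_monp la : zmon (monp la) = zee la.
Proof.
rewrite /zee /zmon (eq_bigr (fun i => (mult la i.+1)`! * i.+1 ^ mult la i.+1)%N).
  2: by move=> i _; rewrite monpE.
rewrite -(big_map S xpredT (fun i => (mult la i)`! * i ^ mult la i)%N).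
apply/perm_big/uniq_perm; rewrite ?undup_uniq ?(map_inj_uniq succn_inj) ?fset_uniq //.
move=> i; rewrite mem_undup; case: i => [|i].
  have /andP[_ /negPf ->] := valP la.
  by apply/negP => /mapP[].
by rewrite (mem_map succn_inj) -cmE_neq0 monpE -lt0n -has_count has_pred1.
Qed.

Lemma msuppU1_sum (K : monomType) (R : nzRingType) (m n : K) (F : K -> R) :
  \sum_(k <- msupp (<< m >> : {malg R[K]})) (<< m >> : {malg R[K]})@_k
       * (<< n >> : {malg R[K]})@_k * F k
  = F m * (m == n)%:R.
Proof.
rewrite msuppU1 big_seq_fset1 !mcoeffU1 eqxx mul1r eq_sym.
by case: eqP => _; rewrite ?mul1r ?mulr1 ?mul0r ?mulr0.
Qed.

Lemma hallU (m n : Mon) : hall << m >> << n >> = (zmon m)%:R * (m == n)%:R.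
Proof. exact: (msuppU1_sum m n (fun k => (zmon k)%:R)). Qed.

Lemma hall_psump la mu :
  hall (psump la) (psump mu) = (zee la)%:R * (la == mu)%:R.
Proof. by rewrite !psumpE hallU zmon_monp (inj_eq monp_inj). Qed.

Lemma tensE f g m n : (f ⊗ g)@_(m, n) = f@_m * g@_n.
Proof. exact: tensorE. Qed.

Lemma tens_linearl (a : rat) f f' g : (a *: f + f') ⊗ g = a *: (f ⊗ g) + f' ⊗ g.
Proof. exact: tensor_linearl. Qed.

Lemma tens_linearr (a : rat) f g g' : f ⊗ (a *: g + g') = a *: (f ⊗ g) + f ⊗ g'.
Proof. exact: tensor_linearr. Qed.

Lemma tens11 : 1 ⊗ 1 = 1.
Proof. exact: tensor11. Qed.

Lemma tensM f g f' g' : (f ⊗ g) * (f' ⊗ g') = (f * f') ⊗ (g * g').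
Proof. exact: tensorM. Qed.

Lemma Delta_mon_mmorphism : mmorphism Delta_mon.
Proof.
have E (m : Mon) (d : {fset nat}) : (finsupp m `<=` d)%fset ->
    Delta_mon m = \prod_(i <- d) (psum i.+1 ⊗ 1 + 1 ⊗ psum i.+1) ^+ m i.
  move=> md; rewrite /Delta_mon (big_fset_incl _ md) // => i _.
  by rewrite -cmE_eq0 => /eqP ->.
split=> [m n|]; last by rewrite /Delta_mon mdom1 big_seq_fset0.
rewrite (E m _ (fsubsetUl _ (finsupp n))) (E n _ (fsubsetUr (finsupp m) _)).
rewrite /Delta_mon mdomD -big_split; apply: eq_bigr => i _.
by rewrite cmM exprD.
Qed.

HB.instance Definition _ :=
  isMultiplicative.Build _ _ Delta_mon Delta_mon_mmorphism.

Lemma DeltaD f g : Delta (f + g) = Delta f + Delta g.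
Proof. exact: mmapD. Qed.

Lemma DeltaZ (a : rat) f : Delta (a *: f) = a *: Delta f.
Proof. by rewrite /Delta mmapZ mul_malgC. Qed.

Lemma Delta1 : Delta 1 = 1.
Proof. exact: mmap1. Qed.

Lemma DeltaM f g : Delta (f * g) = Delta f * Delta g.
Proof. exact: (mmap_is_multiplicative (f := malgC) (h := Delta_mon)).1. Qed.

Lemma Delta_psum k : (0 < k)%N -> Delta (psum k) = psum k ⊗ 1 + 1 ⊗ psum k.
Proof.
case: k => // k _; rewrite /Delta /psum mmapU mul_malgC scale1r /Delta_mon.
by rewrite mdomU big_seq_fset1 cmUU expr1.
Qed.

(* Main.v *)
From HB Require Import structures.
From mathcomp Require Import perm.
Require Import Defs.
From mathcomp Require Import all_boot all_order all_algebra finmap.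
From mathcomp.multinomials Require Import monalg.
From mathcomp Require Import ring.

Set Implicit Arguments.
Unset Strict Implicit.
Unset Printing Implicit Defensive.

Import GRing.Theory.
Local Open Scope ring_scope.

(* Let [Phi0] and [Phi] be the linear maps sending p_ga to \overline{p}_ga and to
   \mathbf{p}_ga, so that \tilde s_la = Phi (s_la). As the q_i are primitive, the
   Vandermonde identity for falling factorials gives
   Delta Phi0 = (Phi0 ⊗ Phi0) Delta. Moreover Phi = Phi0 sigma, where sigma is the
   algebra automorphism p_i |-> p_i - 1, inverse to tau : p_i |-> p_i + 1, which is
   the sum of the skewing operators h_k^⊥. Since Delta sigma = (sigma ⊗ id) Delta,
   Delta Phi = (Phi ⊗ Phi0) Delta = (Phi ⊗ Phi tau) Delta, and the theorem follows
   from Delta s_la = sum c^la_(al, ga) s_al ⊗ s_ga and from the Pieri rule for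
   tau s_ga. The latter is read off the Jacobi-Trudi determinant by subtracting
   from each row the next one. It also yields the orthonormality of the s_la, on
   which the former rests: expand s_la along its first row as
   sum_j h_(la_1 + j) C_j; if mu_1 <= la_1, the operator h_(la_1 + j)^⊥ kills s_mu
   unless j = 0 and mu_1 = la_1, when it removes the first row of mu. Finally
   Phi0 (p_ga) has leading term p_ga, so that the \tilde s_la are independent. *)

(** * Monoid algebras and the coefficients of the coproduct *)

Section LinearExtension.
Variables (K : choiceType) (V : lmodType rat).

Fact linext_key : unit. Proof. by []. Qed.

(* Locked, like [tn], [ps], [hs], [hl], [sch], [qs], [pb] and [pt], which are
   copies of [tens], [psum], [hsym], [hall], [schur], [qsym], [pbar] and [ptil]:
   comparing two distinct unlocked sums over supports makes unification diverge. *)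
Definition linext : (K -> V) -> {malg rat[K]} -> V :=
  locked_with linext_key (fun h f => \sum_(k <- msupp f) f@_k *: h k).

Lemma linextE h f : linext h f = \sum_(k <- msupp f) f@_k *: h k.
Proof. by rewrite /linext unlock. Qed.

Lemma linextEw h (d : {fset K}) f : (msupp f `<=` d)%fset ->
  linext h f = \sum_(k <- d) f@_k *: h k.
Proof.
move=> fd; rewrite linextE (big_fset_incl _ fd) // => k _ /mcoeff_outdom ->.
by rewrite scale0r.
Qed.

Lemma linext_is_linear h : linear (linext h).
Proof.
move=> a f g; pose d := (msupp f `|` msupp g)%fset.
have fd : (msupp f `<=` d)%fset by exact: fsubsetUl.
have gd : (msupp g `<=` d)%fset by exact: fsubsetUr.
have ad : (msupp (a *: f + g) `<=` d)%fset.
  by apply: fsubset_trans (msuppD_le _ _) (fsetSU _ (msuppZ_le _ _)).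
rewrite (linextEw _ fd) (linextEw _ gd) (linextEw _ ad) scaler_sumr -big_split.
by apply: eq_bigr => k _ /=; rewrite mcoeffD mcoeffZ scalerDl scalerA.
Qed.

HB.instance Definition _ h :=
  GRing.isLinear.Build rat {malg rat[K]} V *:%R (linext h) (linext_is_linear h).

Lemma linextU h k : linext h << k >> = h k.
Proof. by rewrite linextE msuppU oner_eq0 big_seq_fset1 mcoeffUU scale1r. Qed.

Lemma malg_scaleE (f : {malg rat[K]}) : f = \sum_(k <- msupp f) f@_k *: << k >>.
Proof.
rewrite {1}(monalgE f); apply: eq_bigr => k _; apply/malgP => l.
by rewrite mcoeffZ !mcoeffU mulrnAr mulr1.
Qed.

Lemma malg_linear_ext (F G : {linear {malg rat[K]} -> V}) :
  (forall k, F << k >> = G << k >>) -> F =1 G.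
Proof.
move=> FG f; rewrite (malg_scaleE f) !linear_sum.
by apply: eq_bigr => k _; rewrite !linearZ /= FG.
Qed.

(** For maps with no declared linear structure, such as composites: the structure is packed on the
    spot from the two linearity proofs. *)
Lemma linear_ext (F G : {malg rat[K]} -> V) : linear F -> linear G ->
  (forall k, F << k >> = G << k >>) -> F =1 G.
Proof.
move=> linF linG FG.
pose F' := HB.pack_for {linear {malg rat[K]} -> V} F
  (GRing.isLinear.Build rat {malg rat[K]} V *:%R _ linF).
pose G' := HB.pack_for {linear {malg rat[K]} -> V} G
  (GRing.isLinear.Build rat {malg rat[K]} V *:%R _ linG).
exact: (malg_linear_ext (F := F') (G := G')).
Qed.

End LinearExtension.

Section MultiplicativeExtension.
Variables (K : monomType) (A : algType rat).

Lemma linextM (h : K -> A) : {morph h : x y / mmul x y >-> x * y} ->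
  {morph linext h : f g / f * g}.
Proof.
move=> hM f g; rewrite malgME [linext h f]linextE [linext h g]linextE mulr_suml linear_sum.
apply: eq_bigr => k _; rewrite mulr_sumr linear_sum; apply: eq_bigr => l _.
have -> : (<< f@_k * g@_l *g mmul k l >> : {malg rat[K]}) =
    (f@_k * g@_l) *: << mmul k l >>.
  by apply/malgP => x; rewrite mcoeffZ !mcoeffU mulrnAr mulr1.
by rewrite linearZ /= linextU hM -scalerAl -scalerAr scalerA.
Qed.

End MultiplicativeExtension.

Section CoefficientOfProduct.
Variable (K : monomType).
Implicit Types (x y k : K) (f : {malg rat[K]}).

Lemma mcoeffUM x f k :
  (<< x >> * f)@_k = \sum_(l <- msupp f) f@_l *+ (mmul x l == k).
Proof.
rewrite malgM_def fgmulUg raddf_sum /=.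
by apply: eq_bigr => l _; rewrite mcoeffU mul1r.
Qed.

Lemma mcoeffUM_mul x y f : injective (mmul x) -> (<< x >> * f)@_(mmul x y) = f@_y.
Proof.
move=> inj_x; rewrite mcoeffUM [in RHS](malg_scaleE f) raddf_sum /=.
apply: eq_bigr => l _.
by rewrite mcoeffZ mcoeffU (inj_eq inj_x) mulrnAr mulr1.
Qed.

Lemma mcoeffUM_eq0 x f k : (forall y, mmul x y != k) -> (<< x >> * f)@_k = 0.
Proof. by move=> xk; rewrite mcoeffUM big1 // => l _; rewrite (negPf (xk l)). Qed.

End CoefficientOfProduct.

Lemma mmulI (m : Mon) : injective (mmul m).
Proof.
move=> x y /(congr1 (fun z : Mon => (z : nat -> nat))) e; apply/eqP/cmP => i.
by move: (congr1 (@^~ i) e); rewrite /= !cmM => /addnI.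
Qed.

Lemma ucm_divK (m : Mon) i : (0 < m i)%N -> mmul (ucm i) (divcm m (ucm i)) = m.
Proof.
move=> mi; apply/eqP/cmP => j; rewrite cmM divcmE cmU.
by case: eqP => [<-|_]; rewrite ?subnKC ?subn0 ?add0n.
Qed.

Lemma ucm_mul_neq (m : Mon) i x : m i = 0%N -> mmul (ucm i) x != m.
Proof. by move=> mi; apply/eqP => e; move: mi; rewrite -e cmM cmUU. Qed.

(** Induction on the total degree [mdeg]: a monomial other than 1 is divisible by some variable, and
    [ucm_divK] splits it off. *)
Lemma Mon_ind (P : Mon -> Prop) :
  P mone -> (forall i m, P m -> P (mmul (ucm i) m)) -> forall m, P m.
Proof.
move=> P1 PM m; have [n] := ubnP (mdeg m); elim: n m => // n IHn m.
rewrite ltnS => mn; have [->//|m1] := eqVneq m mone.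
have [i mi] : exists i, (0 < m i)%N.
  have [e0|[i im]] := fset_0Vmem (finsupp m); last first.
    by exists i; rewrite lt0n cmE_neq0.
  by case/eqP: m1; apply: mdeg_eq0I; rewrite mdegE e0 big_seq_fset0.
rewrite -(ucm_divK mi); apply/PM/IHn.
by move: mn; rewrite -{1}(ucm_divK mi) mdegM mdegU.
Qed.

Lemma psumS_UE i : psum i.+1 = << (ucm i : Mon) >>.
Proof. by []. Qed.

Lemma mcoeff_psumM i (f : Sym) (m : Mon) :
  (psum i.+1 * f)@_m = if (0 < m i)%N then f@_(divcm m (ucm i)) else 0.
Proof.
case: ltnP => mi; last first.
  by apply: mcoeffUM_eq0 => y; apply/ucm_mul_neq/eqP; rewrite -leqn0.
by rewrite -{1}(ucm_divK mi) mcoeffUM_mul //; apply: mmulI.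
Qed.

Lemma malgU_mul (K : monomType) (m n : K) :
  (<< mmul m n >> : {malg rat[K]}) = << m >> * << n >>.
Proof. by rewrite malgUM mulr1. Qed.

Lemma zmonEw (m : Mon) (d : {fset nat}) : (finsupp m `<=` d)%fset ->
  zmon m = (\prod_(i <- d) ((m i)`! * i.+1 ^ m i))%N.
Proof.
move=> md; rewrite /zmon (big_fset_incl _ md) // => i _.
by rewrite -cmE_eq0 => /eqP ->.
Qed.

Lemma zmon_ucmM i (m : Mon) :
  zmon (mmul (ucm i) m) = ((m i).+1 * i.+1 * zmon m)%N.
Proof.
pose d := (i |` finsupp m)%fset.
have md : (finsupp m `<=` d)%fset by exact: fsubsetUr.
have id : i \in d by exact: fset1U1.
rewrite (zmonEw md) (@zmonEw _ d) ?mdomD ?mdomU //.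
rewrite (big_fsetD1 i) // [in RHS](big_fsetD1 i) //= cmM cmUU add1n.
rewrite factS expnS mulnACA -mulnA; congr (_ * (_ * _))%N.
by apply: eq_big_seq => j; rewrite in_fsetD1 cmM cmU [i == j]eq_sym => /andP[/negPf->].
Qed.

Lemma zmon_gt0 m : (0 < zmon m)%N.
Proof.
apply: prodn_gt0 => i; by rewrite muln_gt0 fact_gt0 expn_gt0.
Qed.

Lemma zmon_neq0 m : (zmon m)%:R != 0 :> rat.
Proof. by rewrite Num.Theory.pnatr_eq0 -lt0n zmon_gt0. Qed.

Lemma zmon1 : zmon (mone : Mon) = 1%N.
Proof. by rewrite /zmon mdom1 big_seq_fset0. Qed.

Lemma zmon_div i (m : Mon) : (0 < m i)%N ->
  zmon m = (m i * i.+1 * zmon (divcm m (ucm i)))%N.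
Proof.
by move=> mi; rewrite -{1}(ucm_divK mi) zmon_ucmM divcmE cmUU subn1 prednK.
Qed.

Lemma hall_monom f (m : Mon) : hall f << m >> = f@_m * (zmon m)%:R.
Proof.
rewrite hallC /hall msuppU1 big_seq_fset1.
by rewrite [X in X * _ * _]mcoeffUU mul1r.
Qed.

Lemma DeltaE f : Delta f = linext Delta_mon f.
Proof. by rewrite linextE; apply: eq_bigr => k _; rewrite mul_malgC. Qed.

Lemma Delta_is_linear : linear Delta.
Proof. by move=> a f g; rewrite DeltaD DeltaZ. Qed.

HB.instance Definition _ := GRing.isLinear.Build rat Sym Sym2 *:%R Delta
  Delta_is_linear.

Lemma tensU (m n : Mon) : << m >> ⊗ << n >> = << (m, n) >>.
Proof. by rewrite /tens tensorU mulr1. Qed.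

Lemma mmul_pairI (x : (Mon * Mon)%type) : injective (mmul x).
Proof. by move=> [a b] [c d] [/mmulI -> /mmulI ->]. Qed.

Lemma Delta_psumM i f m n :
  (Delta (psum i.+1 * f))@_(m, n) =
    (if (0 < m i)%N then (Delta f)@_(divcm m (ucm i), n) else 0) +
    (if (0 < n i)%N then (Delta f)@_(m, divcm n (ucm i)) else 0).
Proof.
rewrite DeltaM Delta_psum // mulrDl mcoeffD; congr (_ + _).
  rewrite psumS_UE tensU; case: posnP => mi.
    apply: mcoeffUM_eq0 => -[a b]; apply/eqP => -[e _].
    by move/eqP: (ucm_mul_neq a mi); apply.
  rewrite -(mcoeffUM_mul (divcm m (ucm i), n) (Delta f)
    (@mmul_pairI (ucm i, mone))); congr mcoeff.
  by congr (_, _); rewrite ?ucm_divK ?mul1m.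
rewrite psumS_UE tensU; case: posnP => ni.
  apply: mcoeffUM_eq0 => -[a b]; apply/eqP => -[_ e].
  by move/eqP: (ucm_mul_neq b ni); apply.
rewrite -(mcoeffUM_mul (m, divcm n (ucm i)) (Delta f)
  (@mmul_pairI (mone, ucm i))); congr mcoeff.
by congr (_, _); rewrite ?ucm_divK ?mul1m.
Qed.

Lemma mcoeff1_Sym (m : Mon) : (1 : Sym)@_m = (m == mone)%:R.
Proof. exact: mcoeff1. Qed.

(* [Delta] is adjoint to the product: both sides are [hall f (p_m * p_n)]. *)
Lemma Delta_coef f (m n : Mon) :
  (zmon m)%:R * (zmon n)%:R * (Delta f)@_(m, n) =
  f@_(mmul m n) * (zmon (mmul m n))%:R.
Proof.
suff U k : (zmon m)%:R * (zmon n)%:R * (Delta << k >>)@_(m, n) =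
    (<< k >> : Sym)@_(mmul m n) * (zmon (mmul m n))%:R.
  rewrite (malg_scaleE f) (linear_sum Delta) !raddf_sum mulr_sumr mulr_suml.
  apply: eq_bigr => k _; rewrite linearZ /= !mcoeffZ.
  by rewrite mulrCA U mulrA.
elim/Mon_ind: k m n => [|i k IHk] m n.
  rewrite Delta1 -tens11 tensE !mcoeff1_Sym.
  have -> : (mmul m n == mone) = (m == mone) && (n == mone) by apply/unitmP/andP.
  case: eqP => [->|_]; case: eqP => [->|_]; rewrite ?mul0r ?mulr0 //.
  by rewrite mul1m zmon1 !mulr1.
rewrite malgU_mul -psumS_UE Delta_psumM mcoeff_psumM cmM.
(* [K] is the value given by the induction hypothesis whether p_(i+1) is removed from [m] or from
   [n]. The two cases contribute the multiples m_i (i+1) and n_i (i+1) of it, which add up to the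
   factor in [zmon_div] for the product. *)
set K : rat := (<< k >> : Sym)@_(divcm (mmul m n) (ucm i)) *
  (zmon (divcm (mmul m n) (ucm i)))%:R.
have divM (x y : Mon) : (0 < x i)%N ->
    mmul (divcm x (ucm i)) y = divcm (mmul x y) (ucm i).
  move=> xi; apply/eqP/cmP => j; rewrite cmM !divcmE cmM cmU.
  by case: eqP => [<-|_]; rewrite ?subn0 // addnBAC.
have Em : (zmon m)%:R * (zmon n)%:R *
    (if (0 < m i)%N then (Delta << k >>)@_(divcm m (ucm i), n) else 0)
    = (m i * i.+1)%:R * K.
  case: posnP => mi; first by rewrite mi mul0n mul0r mulr0.
  by rewrite (zmon_div mi) natrM -!mulrA [X in _ * X]mulrA IHk divM.
have En : (zmon m)%:R * (zmon n)%:R *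
    (if (0 < n i)%N then (Delta << k >>)@_(m, divcm n (ucm i)) else 0)
    = (n i * i.+1)%:R * K.
  case: posnP => ni; first by rewrite ni mul0n mul0r mulr0.
  rewrite (zmon_div ni) natrM [X in X * _]mulrCA -!mulrA [X in _ * X]mulrA IHk.
  by rewrite mulmC divM // [mmul n m]mulmC.
rewrite mulrDr Em En -mulrDl -natrD -mulnDl.
(* If p_(i+1) does not divide the product, the quotient in [K] is a truncated one, but [K] then has
   coefficient 0. *)
have [m0|mni] := posnP (m i + n i); first by rewrite m0 mul0n !mul0r.
by rewrite (@zmon_div i (mmul m n)) ?cmM // [in RHS]natrM [RHS]mulrCA.
Qed.

Lemma Delta_coef_hall f (m n : Mon) :
  (Delta f)@_(m, n) = hall f << mmul m n >> / (zmon m)%:R / (zmon n)%:R.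
Proof.
rewrite hall_monom -Delta_coef [X in X / _ / _]mulrC [_%:R * _%:R]mulrC mulrA.
by rewrite !mulfK ?zmon_neq0.
Qed.

(** * Weights and complete symmetric functions *)

(** The grading of Sym with p_(i+1) in degree i+1, whereas [mdeg] counts factors. *)
Definition wdeg (m : Mon) : nat := \sum_(i <- finsupp m) m i * i.+1.

(** Monomials with different supports get the common index set 'I_N, over which their products can
    be multiplied factor by factor. *)
Lemma big_finsupp (R : Type) (idx : R) (op : Monoid.com_law idx)
    (m : Mon) N (F : nat -> R) :
  (forall i, m i = 0%N -> F i = idx) -> (forall i, m i != 0%N -> (i < N)%N) ->
  \big[op/idx]_(i <- finsupp m) F i = \big[op/idx]_(i < N) F i.
Proof.
move=> F0 mN; rewrite -(big_mkord xpredT) /index_iota subn0.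
rewrite [RHS](bigID (fun i => i \in finsupp m)) /= [X in op _ X]big1 ?Monoid.mulm1.
  rewrite -[RHS]big_filter; apply/perm_big/uniq_perm; rewrite ?fset_uniq //.
    exact/filter_uniq/iota_uniq.
  move=> i; rewrite mem_filter mem_iota /= add0n -cmE_neq0.
  by case: eqVneq => //= /mN ->.
by move=> i; rewrite -cmE_eq0 => /eqP/F0.
Qed.

Lemma wdegE (m : Mon) N : (forall i, m i != 0%N -> (i < N)%N) ->
  wdeg m = (\sum_(i < N) m i * i.+1)%N.
Proof. by move=> mN; apply: big_finsupp => // i ->. Qed.

Lemma supp_bound (m : Mon) : exists N, forall i, m i != 0%N -> (i < N)%N.
Proof.
exists (\max_(i <- finsupp m) i).+1 => i; rewrite cmE_neq0 => im.
by rewrite ltnS; apply: leq_bigmax_seq.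
Qed.

Lemma wdegM (m n : Mon) : wdeg (mmul m n) = (wdeg m + wdeg n)%N.
Proof.
have [M mM] := supp_bound m; have [N nN] := supp_bound n.
have [k1 k2] := (leq_maxl M N, leq_maxr M N).
rewrite (@wdegE m (maxn M N)); last by move=> i /mM h; apply: leq_trans h k1.
rewrite (@wdegE n (maxn M N)); last by move=> i /nN h; apply: leq_trans h k2.
rewrite (@wdegE _ (maxn M N)) => [|i].
  by rewrite -big_split; apply: eq_bigr => i _; rewrite cmM mulnDl.
rewrite cmM addn_eq0 negb_and => /orP[/mM h|/nN h].
  exact: leq_trans h k1.
exact: leq_trans h k2.
Qed.

Lemma wdegU i : wdeg (ucm i) = i.+1.
Proof. by rewrite /wdeg mdomU big_seq_fset1 cmUU mul1n. Qed.

Lemma wdeg1 : wdeg mone = 0%N.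
Proof. by rewrite /wdeg mdom1 big_seq_fset0. Qed.

Lemma wdeg_div (m : Mon) i : (0 < m i)%N ->
  wdeg m = (i.+1 + wdeg (divcm m (ucm i)))%N.
Proof. by move=> mi; rewrite -{1}(ucm_divK mi) wdegM wdegU. Qed.

Lemma wdeg_supp (m : Mon) i : m i != 0%N -> (i < wdeg m)%N.
Proof. by rewrite -lt0n => /wdeg_div ->; rewrite addSn ltnS leq_addr. Qed.

Lemma wdeg_monp la : wdeg (monp la) = psize la.
Proof.
rewrite /monp /psize; case: la => s /= /andP[_].
elim: s => [|x s IHs]; first by rewrite big_nil wdeg1.
rewrite inE negb_or big_cons wdegM wdegU => /andP[x0 /IHs ->].
by case: x x0.
Qed.

Lemma geq_total : total geq.
Proof. by move=> x y; apply: leq_total. Qed.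

Lemma monp_surj (m : Mon) : exists la, monp la = m.
Proof.
elim/Mon_ind: m => [|i m [la <-]].
  have nilP : is_intpartn [::] by [].
  by exists (IntPartn nilP); rewrite /monp big_nil.
have sP : is_intpartn (sort geq (i.+1 :: la)).
  rewrite /is_intpartn sort_sorted ?mem_sort; last exact: geq_total.
  by rewrite inE /=; case/andP: (valP la).
exists (IntPartn sP); rewrite /monp /=.
have /permPl e : perm_eql (sort geq (i.+1 :: la)) (i.+1 :: la).
  exact/permPl/permEl/perm_sort.
by rewrite (perm_big _ e) big_cons.
Qed.

Lemma mcoeff_hsym n (m : Mon) :
  (hsym n)@_m = (wdeg m == n)%:R / (zmon m)%:R.
Proof.
have [la <-] := monp_surj m; rewrite wdeg_monp zmon_monp /hsym raddf_sum /=.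
have [lan|lan] := boolP (la \in intpartns n).
  rewrite (bigD1_seq la) ?uniq_intpartns //= big1 => [|mu /negPf mula].
    by rewrite -mem_intpartns lan mcoeffZ psumpE mcoeffUU mulr1 mul1r addr0.
  by rewrite mcoeffZ psumpE mcoeffU (inj_eq monp_inj) mula mulr0.
rewrite -mem_intpartns (negPf lan) mul0r big_seq big1 // => mu mun.
rewrite mcoeffZ psumpE mcoeffU (inj_eq monp_inj).
by case: eqP => [mula|]; [rewrite -mula mun in lan | rewrite mulr0].
Qed.

Lemma hsym0 : hsym 0 = 1.
Proof.
apply/malgP => m; rewrite mcoeff_hsym mcoeff1_Sym.
have [->|m1] := eqVneq m mone; first by rewrite wdeg1 zmon1 divr1.
case: eqP => [w0|]; last by rewrite mul0r.
case/eqP: m1; apply/eqP/cmP => i; rewrite cm1; apply/eqP/contraT => /wdeg_supp.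
by rewrite w0.
Qed.

(** Newton's identity, coefficientwise: removing p_(k+1) from a monomial m of weight n divides z_m
    by m_k (k+1), so the terms on the right add up to the sum of the m_k (k+1) over z_m, which is n
    / z_m. *)
Lemma newton_hsym n :
  n%:R *: hsym n = \sum_(k < n) psum k.+1 * hsym (n - k.+1).
Proof.
apply/malgP => m; rewrite mcoeffZ mcoeff_hsym raddf_sum /=.
have [mn|mn] := eqVneq (wdeg m) n; last first.
  rewrite mul0r mulr0 big1 // => k _; rewrite mcoeff_psumM.
  case: posnP => // /wdeg_div mk; rewrite mcoeff_hsym.
  case: eqP => [e|]; last by rewrite mul0r.
  by case/eqP: mn; rewrite mk e subnKC.
rewrite -{1}mn (wdegE (N := n)) => [|i /wdeg_supp]; last by rewrite mn.
rewrite mul1r raddf_sum mulr_suml; apply: eq_bigr => k _.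
rewrite mcoeff_psumM; case: posnP => [->|mk]; first by rewrite mul0r.
rewrite mcoeff_hsym (zmon_div mk) natrM invfM mulrA mulfV; last first.
  by rewrite Num.Theory.pnatr_eq0 muln_eq0 negb_or -lt0n mk.
suff -> : wdeg (divcm m (ucm (k : nat))) = (n - k.+1)%N by rewrite eqxx.
by have e := wdeg_div mk; rewrite mn in e; rewrite -[LHS](addKn k.+1) -e.
Qed.

(** The specialization p_k |-> 1, that is, evaluation at a single variable equal to 1. *)
Definition eps : Sym -> rat := linext (fun _ : Mon => 1 : rat^o).

Lemma epsM f g : eps (f * g) = eps f * eps g.
Proof. by apply: (@linextM _ rat^o) => x y; rewrite mulr1. Qed.

Lemma eps_psum k : eps (psum k) = 1.
Proof. by rewrite /eps /psum linextU. Qed.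

Lemma eps_is_linear : linear_for *%R eps.
Proof. by move=> a f g; rewrite /eps linearP. Qed.

HB.instance Definition _ :=
  GRing.isLinear.Build rat Sym rat *%R eps eps_is_linear.

(** Strong induction through Newton's identity: n h_n is a sum of n products, each of which
    specializes to 1. *)
Lemma eps_hsym n : eps (hsym n) = 1.
Proof.
have [k] := ubnP n; elim: k n => // k IHk [|n] nk.
  by rewrite hsym0 /eps linextU.
have n0 : n.+1%:R != 0 :> rat by rewrite Num.Theory.pnatr_eq0.
apply: (mulfI n0); rewrite mulr1 -[LHS](linearZ_LR eps) newton_hsym linear_sum /=.
under eq_bigr => i _.
  rewrite epsM eps_psum mul1r IHk; last first.
    by rewrite subSS (leq_ltn_trans (leq_subr _ _)) //.
  over.
by rewrite sumr_const card_ord.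
Qed.

(** * Coproduct and skewing *)

Fact tn_key : unit. Proof. by []. Qed.
Fact ps_key : unit. Proof. by []. Qed.
Fact hs_key : unit. Proof. by []. Qed.
Fact hl_key : unit. Proof. by []. Qed.

Definition tn : Sym -> Sym -> Sym2 := locked_with tn_key tens.
Definition ps : nat -> Sym := locked_with ps_key psum.
Definition hs : nat -> Sym := locked_with hs_key hsym.
Definition hl : Sym -> Sym -> rat := locked_with hl_key hall.
Definition delta : Sym -> Sym2 := linext Delta_mon.

Lemma tn_tens : tens = tn. Proof. by rewrite /tn unlock. Qed.
Lemma ps_psum : psum = ps. Proof. by rewrite /ps unlock. Qed.
Lemma hs_hsym : hsym = hs. Proof. by rewrite /hs unlock. Qed.
Lemma hl_hall : hall = hl. Proof. by rewrite /hl unlock. Qed.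

Lemma tnE f g m n : (tn f g)@_(m, n) = f@_m * g@_n.
Proof. by rewrite -tn_tens tensE. Qed.

Lemma tn_is_linear f : linear (tn f).
Proof. by move=> a g g'; rewrite -tn_tens tens_linearr. Qed.

HB.instance Definition _ f :=
  GRing.isLinear.Build rat Sym Sym2 *:%R (tn f) (tn_is_linear f).

(** The arguments are exchanged so that linearity in the left factor can be declared as a structure
    on a partial application. *)
Definition tnl (g f : Sym) : Sym2 := tn f g.

Lemma tnl_is_linear g : linear (tnl g).
Proof. by move=> a f f'; rewrite /tnl -tn_tens tens_linearl. Qed.

HB.instance Definition _ g :=
  GRing.isLinear.Build rat Sym Sym2 *:%R (tnl g) (tnl_is_linear g).

Lemma tnZl a f g : tn (a *: f) g = a *: tn f g.
Proof. exact: (linearZ_LR (tnl g)). Qed.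

Lemma tnZr a f g : tn f (a *: g) = a *: tn f g.
Proof. exact: (linearZ_LR (tn f)). Qed.

Lemma tn_suml I (r : seq I) (P : pred I) (F : I -> Sym) g :
  tn (\sum_(i <- r | P i) F i) g = \sum_(i <- r | P i) tn (F i) g.
Proof. exact: (linear_sum (tnl g)). Qed.

Lemma tn_sumr I (r : seq I) (P : pred I) (F : I -> Sym) f :
  tn f (\sum_(i <- r | P i) F i) = \sum_(i <- r | P i) tn f (F i).
Proof. exact: (linear_sum (tn f)). Qed.

Lemma tnM f g f' g' : tn f g * tn f' g' = tn (f * f') (g * g').
Proof. by rewrite -tn_tens tensM. Qed.

Lemma tn11 : tn 1 1 = 1.
Proof. by rewrite -tn_tens tens11. Qed.

Lemma tnU (m n : Mon) : tn << m >> << n >> = << (m, n) >>.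
Proof. by rewrite -tn_tens tensU. Qed.

Lemma tn_scaleE f g :
  tn f g = \sum_(m <- msupp f) \sum_(n <- msupp g) (f@_m * g@_n) *: << (m, n) >>.
Proof.
rewrite {1}(malg_scaleE f) tn_suml; apply: eq_bigr => m _.
rewrite {1}(malg_scaleE g) tn_sumr; apply: eq_bigr => n _.
by rewrite tnZl tnZr scalerA tnU.
Qed.

Lemma Delta_delta f : Delta f = delta f.
Proof. exact: DeltaE. Qed.

Lemma delta_is_linear : linear delta.
Proof. exact: linext_is_linear. Qed.

HB.instance Definition _ :=
  GRing.isLinear.Build rat Sym Sym2 *:%R delta delta_is_linear.

Lemma delta_is_multiplicative : multiplicative delta.
Proof.
split=> [f g|]; rewrite -!Delta_delta; [exact: DeltaM | exact: Delta1].
Qed.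

HB.instance Definition _ :=
  GRing.isMultiplicative.Build Sym Sym2 delta delta_is_multiplicative.

Lemma ps_U i : ps i.+1 = << (ucm i : Mon) >>.
Proof. by rewrite -ps_psum. Qed.

Lemma delta_ps k : (0 < k)%N -> delta (ps k) = tn (ps k) 1 + tn 1 (ps k).
Proof. by move=> k0; rewrite -Delta_delta -ps_psum -tn_tens Delta_psum. Qed.

Lemma hl_monom f (m : Mon) : hl f << m >> = f@_m * (zmon m)%:R.
Proof. by rewrite -hl_hall hall_monom. Qed.

Lemma mcoeff_delta f (m n : Mon) :
  (delta f)@_(m, n) = hl f << mmul m n >> / (zmon m)%:R / (zmon n)%:R.
Proof. by rewrite -Delta_delta -hl_hall Delta_coef_hall. Qed.

Lemma mcoeff_hs n (m : Mon) : (hs n)@_m = (wdeg m == n)%:R / (zmon m)%:R.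
Proof. by rewrite -hs_hsym mcoeff_hsym. Qed.

Lemma eps_ps k : eps (ps k) = 1.
Proof. by rewrite -ps_psum eps_psum. Qed.

Lemma eps_hs n : eps (hs n) = 1.
Proof. by rewrite -hs_hsym eps_hsym. Qed.

Lemma eps1 : eps 1 = 1.
Proof. by rewrite /eps linextU. Qed.

Lemma epsE g : eps g = \sum_(n <- msupp g) g@_n.
Proof. by rewrite /eps linextE; apply: eq_bigr => n _; rewrite -[RHS]mulr1. Qed.

(** This is id ⊗ [eps], because [eps] is 1 on every monomial. *)
Definition contr : Sym2 -> Sym := linext (fun mn : (Mon * Mon)%type => << mn.1 >>).

Lemma contr_is_linear : linear contr.
Proof. exact: linext_is_linear. Qed.

HB.instance Definition _ :=
  GRing.isLinear.Build rat Sym2 Sym *:%R contr contr_is_linear.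

Lemma contrM f g : contr (f * g) = contr f * contr g.
Proof. by apply: linextM => -[a b] [c d] /=; rewrite malgU_mul. Qed.

Lemma contrU m n : contr << (m, n) >> = << m >>.
Proof. exact: linextU. Qed.

Lemma contr_tn f g : contr (tn f g) = eps g *: f.
Proof.
rewrite tn_scaleE (linear_sum contr) /= [in RHS](malg_scaleE f) scaler_sumr.
apply: eq_bigr => m _; rewrite (linear_sum contr) /= epsE scaler_suml.
by apply: eq_bigr => n _; rewrite (linearZ_LR contr) /= contrU scalerA mulrC.
Qed.

(* [p_k |-> p_k + 1], the sum of the skewing operators by all the [h_k] *)
Definition tau (f : Sym) : Sym := contr (delta f).

Lemma tau_is_linear : linear tau.
Proof. by move=> a f g; rewrite /tau (linearP delta) (linearP contr). Qed.

HB.instance Definition _ := GRing.isLinear.Build rat Sym Sym *:%R tau tau_is_linear.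

Lemma tau_is_multiplicative : multiplicative tau.
Proof.
split=> [f g|]; first by rewrite /tau (rmorphM delta) contrM.
by rewrite /tau (rmorph1 delta); apply: contrU.
Qed.

HB.instance Definition _ := GRing.isMultiplicative.Build Sym Sym tau
  tau_is_multiplicative.

Lemma tau_ps k : (0 < k)%N -> tau (ps k) = ps k + 1.
Proof.
move=> k0; rewrite /tau delta_ps // (linearD contr) /= !contr_tn.
by rewrite eps1 eps_ps !scale1r.
Qed.

Lemma mcoeff_U (m n : Mon) : (<< m >> : Sym)@_n = (m == n)%:R.
Proof. exact: mcoeffU. Qed.

(** At p_a ⊗ p_b both sides have coefficient 1 / (z_a z_b) if the weights of a and b add up to n,
    and 0 otherwise; on the right only the term k = [wdeg a] can contribute. *)
Lemma delta_hs n : delta (hs n) = \sum_(k < n.+1) tn (hs k) (hs (n - k)).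
Proof.
apply/malgP => -[a b]; rewrite mcoeff_delta hl_monom mcoeff_hs.
rewrite mulfVK ?zmon_neq0 // wdegM raddf_sum /=.
have [e|ne] := eqVneq (wdeg a + wdeg b)%N n; last first.
  rewrite !mul0r big1 // => k _; rewrite tnE !mcoeff_hs.
  case: eqP => [ka|]; last by rewrite !mul0r.
  case: eqP => [kb|]; last by rewrite mul0r mulr0.
  by case/eqP: ne; rewrite ka kb subnKC // -ltnS.
have an : (wdeg a < n.+1)%N by rewrite ltnS -e leq_addr.
rewrite (bigD1 (Ordinal an)) //= tnE !mcoeff_hs eqxx.
rewrite (_ : n - wdeg a = wdeg b)%N ?eqxx; last by rewrite -e addKn.
rewrite big1 ?addr0 => [|k]; first by rewrite mulrA mulr1.
move/eqP => ka; rewrite tnE !mcoeff_hs; case: eqP => [e'|]; rewrite ?mul0r //.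
by case: ka; apply: val_inj.
Qed.

Lemma tau_hs n : tau (hs n) = \sum_(k < n.+1) hs k.
Proof.
rewrite /tau delta_hs (linear_sum contr) /=; apply: eq_bigr => k _.
by rewrite contr_tn eps_hs scale1r.
Qed.

(** * Homogeneous symmetric functions *)

Definition homog (n : nat) (f : Sym) : Prop :=
  forall m : Mon, wdeg m != n -> f@_m = 0.

Lemma homog0 n : homog n 0.
Proof. by move=> m _; rewrite mcoeff0. Qed.

Lemma homogD n f g : homog n f -> homog n g -> homog n (f + g).
Proof. by move=> fn gn m mn; rewrite mcoeffD fn // gn // addr0. Qed.

Lemma homogZ n a f : homog n f -> homog n (a *: f).
Proof. by move=> fn m mn; rewrite mcoeffZ fn // mulr0. Qed.

Lemma homogM n p f g : homog n f -> homog p g -> homog (n + p) (f * g).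
Proof.
move=> fn gp m mnp; apply: mcoeff_outdom; apply/negP => /msuppM_le.
case=> [x [y [xf yg e]]]; move: xf yg; rewrite -!mcoeff_neq0 => xf yg.
case/eqP: mnp; rewrite e wdegM.
have -> : wdeg x = n by apply/eqP; apply: contraNT xf => /fn ->.
by have -> : wdeg y = p by apply/eqP; apply: contraNT yg => /gp ->.
Qed.

Lemma homog1 : homog 0 1.
Proof.
move=> m m0; rewrite mcoeff1_Sym; case: eqP => // e.
by move: m0; rewrite e wdeg1.
Qed.

Lemma homog_sum n I (r : seq I) (P : pred I) (F : I -> Sym) :
  (forall i, P i -> homog n (F i)) -> homog n (\sum_(i <- r | P i) F i).
Proof. by move=> Fn; elim/big_rec: _ => [|i f Pi]; [apply: homog0 | apply/homogD/Fn]. Qed.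

Lemma homog_prod I (r : seq I) (d : I -> nat) (F : I -> Sym) :
  (forall i, homog (d i) (F i)) -> homog (\sum_(i <- r) d i) (\prod_(i <- r) F i).
Proof.
move=> Fd; elim: r => [|i r IHr]; first by rewrite !big_nil; apply: homog1.
by rewrite !big_cons; apply: homogM.
Qed.

Lemma homog_hs n : homog n (hs n).
Proof. by move=> m /negPf mn; rewrite mcoeff_hs mn mul0r. Qed.

Lemma psize_part la : psize la = (\sum_(i < size la) part la i)%N.
Proof.
rewrite /psize sumnE (big_nth 0%N) big_mkord.
by apply: eq_bigr.
Qed.

Fact sch_key : unit. Proof. by []. Qed.
Definition sch : intpartn -> Sym := locked_with sch_key schur.

Lemma sch_schur : schur = sch. Proof. by rewrite /sch unlock. Qed.

(** In the Jacobi-Trudi determinant the term of a permutation s has degree equal to the sum of la_i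
    - i + s(i), which is |la| since the i and the s(i) have the same sum. *)
Lemma homog_sch la : homog (psize la) (sch la).
Proof.
rewrite -sch_schur /schur hs_hsym.
apply: homog_sum => s _; rewrite mulr_sign; set f := \prod_(i < _) _.
suff fla : homog (psize la) f.
  by case: ifP => _ //; rewrite -scaleN1r; apply: homogZ.
(* Either some index is negative and the product has a zero factor, or all the truncated
   subtractions are exact. *)
have [/existsP[i ni]|] :=
    boolP [exists i : 'I_(size la), ~~ (i <= part la i + s i)%N].
  by rewrite /f (bigD1 i) //= mxE (negPf ni) mul0r; apply: homog0.
rewrite negb_exists => /forallP si.
have -> : psize la = (\sum_(i < size la) (part la i + s i - i))%N.
  apply/eqP; rewrite -(eqn_add2r (\sum_(i < size la) (i : nat))) -big_split /=.
  rewrite [X in _ == X](eq_bigr (fun i : 'I__ => part la i + s i)%N) => [|i _]; last first.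
    by apply: subnK; move/negPn: (si i).
  have es : (\sum_(i < size la) s i = \sum_(i < size la) i)%N.
    by rewrite [RHS](reindex_inj (perm_inj (s := s))).
  by rewrite big_split /= es psize_part.
apply: homog_prod => i; rewrite mxE.
by have := si i; rewrite negbK => ->; apply: homog_hs.
Qed.

Lemma homog_expand n f : homog n f ->
  f = \sum_(ga <- intpartns n)
        (hl f << monp ga >> / (zee ga)%:R) *: << monp ga >>.
Proof.
move=> fn; apply/malgP => m; have [la <-] := monp_surj m.
rewrite raddf_sum /= (eq_bigr (fun ga => f@_(monp ga) * (ga == la)%:R)); last first.
  move=> ga _; rewrite mcoeffZ hl_monom zmon_monp mcoeff_U.
  by rewrite (inj_eq monp_inj) mulfK // -zmon_monp zmon_neq0.
have [lan|lan] := boolP (la \in intpartns n).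
  rewrite (bigD1_seq la) ?uniq_intpartns //= eqxx mulr1 big1 ?addr0 //.
  by move=> ga /negPf ->; rewrite mulr0.
rewrite fn ?wdeg_monp -?mem_intpartns // big_seq big1 // => ga gan.
by case: eqP => [e|]; [rewrite -e gan in lan | rewrite mulr0].
Qed.

(** * Partitions and horizontal strips *)

Lemma part_ge0 (la : intpartn) i : (size la <= i)%N -> part la i = 0%N.
Proof. exact: nth_default. Qed.

Lemma part_gt0 (la : intpartn) i : (0 < part la i)%N = (i < size la)%N.
Proof.
have [ila|lai] := ltnP i (size la); last by rewrite part_ge0.
rewrite lt0n; apply/eqP => p0.
by have /andP[_ /negP[]] := valP la; rewrite -p0 mem_nth.
Qed.

Lemma part_mono (la : intpartn) i j : (i <= j)%N -> (part la j <= part la i)%N.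
Proof.
move=> ij; have [jla|laj] := ltnP j (size la); last by rewrite part_ge0.
have /andP[sla _] := valP la.
have tr : transitive geq by move=> x y z /= h1 h2; apply: leq_trans h2 h1.
have re : reflexive geq by move=> x /=.
by apply: (sorted_leq_nth tr re 0%N sla) => //; rewrite inE ?(leq_ltn_trans ij).
Qed.

Lemma part_inj la mu : part la =1 part mu -> la = mu.
Proof.
have le_size x y : part x =1 part y -> (size y <= size x)%N.
  by move=> e; rewrite leqNgt -part_gt0 -e part_gt0 ltnn.
move=> e; have sz : size la = size mu.
  by apply/eqP; rewrite eqn_leq !le_size // => i; rewrite e.
by apply: val_inj; apply: (@eq_from_nth _ 0%N) => // i _; apply: e.
Qed.

Lemma psize_partw (la : intpartn) l : (size la <= l)%N -> psize la = (\sum_(i < l) part la i)%N.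
Proof.
move=> sl; rewrite psize_part -(subnK sl) addnC big_split_ord /= [X in (_ + X)%N]big1.
  by rewrite addn0.
by move=> i _; rewrite part_ge0 // leq_addr.
Qed.

(** The zeros of a weakly decreasing sequence stand at its end, where they agree with the default
    value 0. *)
Lemma nth_filter_gt0 (s : seq nat) i :
  sorted geq s -> nth 0%N [seq x <- s | (0 < x)%N] i = nth 0%N s i.
Proof.
elim: s i => [|x s IHs] i //= xs; have ss := path_sorted xs.
case: posnP => [x0|xp]; last by case: i => //= i; apply: IHs.
have s0 : all (pred1 0%N) s.
  apply/allP => y ys /=; rewrite -leqn0 -x0.
  have tr : transitive geq by move=> a b c /= h1 h2; apply: leq_trans h2 h1.
  by have /allP/(_ _ ys) := order_path_min tr xs.
have -> : [seq y <- s | (0 < y)%N] = [::].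
  by apply/eqP; rewrite -[_ == _]negbK -has_filter -all_predC;
     apply: sub_all s0 => y /eqP ->.
rewrite nth_nil x0; case: i => //= i.
have [si|si] := ltnP i (size s); last by rewrite nth_default.
by move/all_nthP: s0 => /(_ 0%N i si)/eqP.
Qed.

Lemma part_exists (f : nat -> nat) l :
  (forall i, f i.+1 <= f i)%N -> f l = 0%N -> exists la, part la =1 f.
Proof.
move=> fS fl; have fl0 i : (l <= i)%N -> f i = 0%N.
  elim: i => [|i IHi]; first by rewrite leqn0 => /eqP l0; rewrite l0 in fl.
  rewrite leq_eqVlt => /predU1P[<-//|/IHi fi].
  by apply/eqP; rewrite -leqn0 -fi.
have sf : sorted geq (mkseq f l).
  apply/(sortedP 0%N) => i; rewrite size_mkseq => il.
  by rewrite /= !nth_mkseq // ltnW.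
have lP : is_intpartn [seq x <- mkseq f l | (0 < x)%N].
  rewrite /is_intpartn mem_filter ltnn andbT; apply: sorted_filter => //.
  by move=> x y z /= h1 h2; apply: leq_trans h2 h1.
exists (IntPartn lP) => i; rewrite /part /= nth_filter_gt0 //.
have [il|li] := ltnP i l; first by rewrite nth_mkseq.
by rewrite nth_default ?size_mkseq // fl0.
Qed.

(** Two cells of one column in rows x < y would give be_x <= j < ga_y <= ga_(x+1), against
    interlacing. Conversely, if be_i < ga_(i+1), the column be_i has cells in both rows i and
    i+1. *)
Lemma hstripP ga be :
  reflect (forall i, part ga i.+1 <= part be i <= part ga i)%N (hstrip ga be).
Proof.
have subP : reflect (forall i, part be i <= part ga i)%N (part_sub be ga).
  apply: (iffP forallP) => [h i|h i //].
  have [ib|bi] := ltnP i (size be); last by rewrite part_ge0.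
  exact: (h (Ordinal ib)).
apply: (iffP andP) => [[/subP bg /forallP cols] i|h]; last first.
  split; first by apply/subP => i; case/andP: (h i).
  apply/forallP => j; apply/card_le1_eqP => /= i k.
  rewrite !inE /skew_cell => /andP[bi gi] /andP[bk gk]; apply: val_inj => /=.
  have contra x y : (part be x <= j)%N -> (j < part ga y)%N -> (y <= x)%N.
    move=> bx gy; rewrite leqNgt; apply/negP => xy.
    have /andP[hx _] := h x.
    have := leq_trans (leq_trans gy (part_mono ga xy)) (leq_trans hx bx).
    by rewrite ltnn.
  by apply/eqP; rewrite eqn_leq (contra k i) // (contra i k).
rewrite bg andbT leqNgt; apply/negP => bi.
have gi : (part be i < part ga i)%N := leq_trans bi (part_mono ga (leqnSn i)).
have g0 : (part be i < part ga 0)%N := leq_trans gi (part_mono ga (leq0n i)).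
have iS : (i.+1 < size ga)%N by rewrite -part_gt0 (leq_ltn_trans _ bi).
have /card_le1_eqP/(_ (Ordinal (ltnW iS)) (Ordinal iS)) := cols (Ordinal g0).
rewrite !inE /skew_cell /= leqnn gi bi (leq_trans (part_mono be (leqnSn i))) //.
by move=> /(_ isT isT)/(congr1 val)/= /eqP; rewrite (gtn_eqF (ltnSn i)).
Qed.

Lemma hstrip_size ga be : hstrip ga be -> (size be <= size ga)%N.
Proof.
move/hstripP => h; rewrite leqNgt -part_gt0 -leqNgt.
by have /andP[_ /leq_trans] := h (size ga); apply; rewrite part_ge0.
Qed.

Lemma hstrip_psize ga be : hstrip ga be -> (psize be <= psize ga)%N.
Proof.
move=> h; rewrite (psize_partw (hstrip_size h)) psize_part.
by apply: leq_sum => i _; case/andP: (hstripP _ _ h i).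
Qed.

Lemma leq_psize_hstrip ga be : hstrip ga be -> (psize ga <= psize be + part ga 0)%N.
Proof.
move=> h; rewrite (psize_partw (leqnSn _)) (psize_partw (hstrip_size h)).
rewrite big_ord_recl addnC leq_add2r; apply: leq_sum => i _.
by case/andP: (hstripP _ _ h i).
Qed.

(** The equality case of [leq_psize_hstrip]: all the inequalities ga_(i+1) <= be_i, summed there,
    must be equalities. *)
Lemma hstrip_first_row ga be : hstrip ga be ->
  (psize be + part ga 0 <= psize ga)%N -> forall i, part be i = part ga i.+1.
Proof.
move=> h le i; have [ig|gi] := ltnP i (size ga); last first.
  rewrite !part_ge0 //; first exact: leq_trans gi _.
  exact: leq_trans (hstrip_size h) gi.
move: le; rewrite (psize_partw (leqnSn (size ga))) (psize_partw (hstrip_size h)).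
rewrite big_ord_recl addnC leq_add2l.
rewrite (bigD1 (Ordinal ig)) //= [leqRHS](bigD1 (Ordinal ig)) //= => le.
apply/eqP; rewrite eqn_leq; case/andP: (hstripP _ _ h i) => -> _; rewrite andbT.
rewrite leqNgt; apply/negP => lt; move: le; apply/negP; rewrite -ltnNge.
rewrite -addSn leq_add // leq_sum // => j _.
by case/andP: (hstripP _ _ h j).
Qed.

(** * Jacobi-Trudi determinants *)

(** Multilinearity of the determinant in its rows, with one summand chosen in each row. *)
Lemma det_sum_rows (R : comNzRingType) l (J : finType) (P : 'I_l -> pred J)
    (F : 'I_l -> J -> 'I_l -> R) :
  \det (\matrix_(i, j) \sum_(k | P i k) F i k j) =
  \sum_(f in family P) \det (\matrix_(i, j) F i (f i) j).
Proof.
rewrite /determinant exchange_big /=; apply: eq_bigr => s _.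
rewrite (eq_bigr (fun i => \sum_(k | P i k) F i k (s i))) => [|i _]; last first.
  by rewrite mxE.
rewrite bigA_distr_big_dep mulr_sumr; apply: eq_bigr => f _.
by congr (_ * _); apply: eq_bigr => i _; rewrite mxE.
Qed.

Section JacobiTrudi.
Variables (R : comNzRingType) (h : nat -> R).

(** h_(a-b) with the convention h_k = 0 for k < 0; two arguments keep possibly negative indices
    within [nat]. *)
Definition hz (a b : nat) : R := if (b <= a)%N then h (a - b) else 0.

(** The number of rows is a parameter because [be] may have fewer parts than [ga] when ga/be is a
    horizontal strip; [jt_part] shows that extra zero parts are harmless. *)
Definition jt (l : nat) (f : nat -> nat) : R :=
  \det (\matrix_(i < l, j < l) hz (f i + j) i).

Hypothesis h0 : h 0 = 1.

(** The last row consists of the h_(j-l) with j <= l, hence of zeros followed by h_0 = 1. *)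
Lemma jt_last l f : f l = 0%N -> jt l.+1 f = jt l f.
Proof.
move=> fl; rewrite /jt (expand_det_row _ ord_max) (bigD1 ord_max) //=.
rewrite big1 => [|j jl]; last first.
  rewrite mxE /= fl add0n /hz leqNgt (_ : j < l)%N ?mul0r //=.
  by rewrite ltn_neqAle -ltnS ltn_ord andbT; apply: contraNneq jl => e; apply/eqP/val_inj.
rewrite addr0 mxE /= fl add0n /hz leqnn subnn h0 mul1r /cofactor addnn -signr_odd.
rewrite odd_double expr0 mul1r; congr determinant; apply/matrixP => i j.
by rewrite !mxE !lift_max.
Qed.

Lemma jt_part (la : intpartn) l : (size la <= l)%N ->
  jt l (part la) = jt (size la) (part la).
Proof.
move/subnK <-; elim: (l - size la)%N => // k IHk.
by rewrite addSn jt_last // part_ge0 // leq_addl.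
Qed.

Variable tau : {rmorphism R -> R}.
Hypothesis tau_h : forall n, tau (h n) = \sum_(k < n.+1) h k.

Lemma rmorph_hz a b : tau (hz a b) = \sum_(0 <= c < a.+1) hz c b.
Proof.
rewrite {1}/hz; case: leqP => ba.
  rewrite tau_h (big_cat_nat (n := b)) ?leqW //= [X in _ = X + _]big_nat.
  rewrite [X in _ = X + _]big1 ?add0r => [|c /andP[_ cb]]; last first.
    by rewrite /hz leqNgt cb.
  rewrite -[X in index_iota X _]add0n big_addn subSn // big_mkord.
  by apply: eq_bigr => c _; rewrite /hz leq_addl addnK.
rewrite rmorph0 big_nat big1 // => c /andP[_]; rewrite ltnS => ca.
by rewrite /hz leqNgt (leq_ltn_trans ca ba).
Qed.

(** Lowering the second index lets consecutive rows be compared: both become initial segments of the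
    same sum over c. *)
Lemma rmorph_hzS a b : tau (hz a b.+1) = \sum_(0 <= c < a) hz c b.
Proof. by rewrite rmorph_hz big_nat_recl // add0r. Qed.

(* Subtracting from each row of the determinant the next one leaves in row [i]
   the sum of the rows that have a part between [g (i+1)] and [g i]. *)
Lemma rmorph_jt l (g : nat -> nat) N :
    (forall i, g i.+1 <= g i)%N -> g l = 0%N -> (g 0 < N)%N ->
  tau (jt l g) =
  \sum_(f in family (fun i : 'I_l => [pred b : 'I_N | g i.+1 <= b <= g i]%N))
     \det (\matrix_(i < l, j < l) hz (f i + j) i).
Proof.
move=> gS gl gN; rewrite -(det_sum_rows _ (fun (i : 'I_l) (b : 'I_N) (j : 'I_l) => hz (b + j) i)).
rewrite -det_map_mx.
have gN' i : (g i < N)%N.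
  by elim: i => // i; apply: leq_ltn_trans.
set A := map_mx tau _.
(* Left multiplication by the unitriangular matrix [U] performs the row subtractions and keeps the
   determinant. *)
pose U : 'M[R]_l := \matrix_(i, k) ((i == k)%:R - (i.+1 == k)%:R).
have detU : \det U = 1.
  rewrite -det_tr det_trig; last first.
    apply/is_trig_mxP => i j ij; rewrite !mxE -val_eqE /= gtn_eqF //.
    by rewrite gtn_eqF ?subr0 // ltnW.
  by apply: big1 => i _; rewrite !mxE eqxx gtn_eqF ?subr0.
rewrite -[LHS]mul1r -detU -det_mulmx; congr determinant; apply/matrixP => i j.
rewrite !mxE.
under eq_bigr => k _ do rewrite !mxE mulrBl.
rewrite sumrB (bigD1 i) //= eqxx mul1r big1 ?addr0; last first.
  by move=> k; rewrite eq_sym => /negPf ->; rewrite mul0r.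
(* The row to be subtracted. For i+1 = l there is none, and the right side vanishes too: g l = 0
   leaves c < j <= i, where [hz c i] is 0. *)
have -> : \sum_(k < l) (i.+1 == k)%:R * tau (hz (g k + j) k) =
    \sum_(0 <= c < g i.+1 + j) hz c i.
  have [il|il] := ltnP i.+1 l.
    rewrite (bigD1 (Ordinal il)) //= eqxx mul1r big1 ?addr0 ?rmorph_hzS //.
    move=> k; rewrite -val_eqE /= eq_sym => /negPf ->; exact: mul0r.
  have -> : i.+1 = l by apply/eqP; rewrite eqn_leq il ltn_ord.
  rewrite gl big1 => [|k _]; last by rewrite gtn_eqF ?mul0r.
  rewrite add0n big_nat big1 // => c /andP[_ cj].
  rewrite /hz leqNgt (leq_trans cj) // -ltnS.
  by apply: leq_trans (ltn_ord j) _.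
(* What remains are the c from g (i+1) + j to g i + j; the substitution c = b + j gives the range of
   b in the family. *)
rewrite rmorph_hz (big_cat_nat (n := (g i.+1 + j)%N)) //=; last first.
  by rewrite ltnW // ltnS leq_add2r.
rewrite addrAC subrr add0r -addSn big_addn addnK.
rewrite (big_nat_widen _ _ _ _ _ (gN' i)) (big_nat_widenl _ 0) // big_mkord.
by apply: eq_bigl => b; rewrite /= andbC ltnS.
Qed.

(** The choices of one part per row in [rmorph_jt] are exactly the partitions interlacing with [ga],
    which by [hstripP] are the [be] with ga/be a horizontal strip. *)
Theorem rmorph_jt_hstrip (ga : intpartn) :
  tau (jt (size ga) (part ga)) =
  \sum_(be <- intpartns_le (psize ga) | hstrip ga be) jt (size be) (part be).
Proof.
set l := size ga; set N := (part ga 0).+1.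
have g_le i : (part ga i < N)%N by rewrite ltnS part_mono.
rewrite (rmorph_jt (fun i => part_mono ga (leqnSn i)) (part_ge0 (leqnn l)) (g_le 0)).
(* The bijection from strips to choices; [inord] loses nothing because be_i <= ga_i < N. *)
pose e (be : intpartn) : {ffun 'I_l -> 'I_N} := [ffun i : 'I_l => inord (part be i)].
have eE be i : hstrip ga be -> e be i = part be i :> nat.
  move/hstripP => gb; rewrite ffunE inordK //.
  by have /andP[_ /leq_ltn_trans] := gb i; apply.
rewrite -[RHS]big_filter; set S := filter _ _.
have memS be : (be \in S) = hstrip ga be.
  by rewrite mem_filter mem_intpartns_le andb_idr //; apply: hstrip_psize.
rewrite [RHS](eq_big_seq (fun be => \det (\matrix_(i < l, j < l) hz (e be i + j) i))).
  2: { move=> be; rewrite memS => gb; rewrite -(jt_part (hstrip_size gb)) /jt.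
       by congr determinant; apply/matrixP => i j; rewrite !mxE eE. }
rewrite -(big_map e xpredT (fun f : {ffun 'I_l -> 'I_N} =>
  \det (\matrix_(i < l, j < l) hz (f i + j) i))) -big_enum.
apply/perm_big/uniq_perm; rewrite ?enum_uniq //.
  rewrite map_inj_in_uniq => [|la mu]; first exact/filter_uniq/uniq_intpartns_le.
  rewrite !memS => hl hm elm; apply: part_inj => i.
  have [il|li] := ltnP i l; last first.
    by rewrite !part_ge0 // (leq_trans _ li) // hstrip_size.
  by rewrite -(eE _ (Ordinal il) hl) elm eE.
move=> f; rewrite mem_enum; apply/familyP/mapP => [fP|[be]].
  have fnth (i : 'I_l) : nth 0%N [seq val (f i) | i <- enum 'I_l] i = f i.
    by rewrite (nth_map i) ?size_enum_ord // nth_ord_enum.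
  (* A choice is automatically weakly decreasing: f(i+1) <= ga_(i+1) <= f(i). *)
  have [be beE] : exists be, part be =1 nth 0%N [seq val (f i) | i <- enum 'I_l].
    apply: (@part_exists _ l) => [i|]; last first.
      by rewrite nth_default // size_map size_enum_ord.
    have [il|li] := ltnP i.+1 l; last first.
      by rewrite nth_default // size_map size_enum_ord.
    rewrite (fnth (Ordinal il)) (fnth (Ordinal (ltnW il))).
    have /andP[h1 _] := fP (Ordinal (ltnW il)).
    have /andP[_ h2] := fP (Ordinal il).
    exact: leq_trans h2 h1.
  have fE (i : 'I_l) : part be i = f i.
    by rewrite beE fnth.
  have gb : hstrip ga be.
    apply/hstripP => i; have [il|li] := ltnP i l.
      by rewrite (fE (Ordinal il)); apply: (fP (Ordinal il)).
    by rewrite (part_ge0 (leqW li)) beE nth_default // size_map size_enum_ord.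
  exists be; rewrite ?memS //; apply/ffunP => i.
  by apply: val_inj; rewrite /= eE.
rewrite memS => gb -> i; rewrite inE eE //.
exact: (hstripP _ _ gb).
Qed.

End JacobiTrudi.

(** * Schur functions *)

Lemma hlC f g : hl f g = hl g f.
Proof. by rewrite -hl_hall hallC. Qed.

Lemma hl_is_linear f : linear_for *%R (hl f).
Proof. by move=> a g h; rewrite -hl_hall hall_linear. Qed.

HB.instance Definition _ f :=
  GRing.isLinear.Build rat Sym rat *%R (hl f) (hl_is_linear f).

Lemma hlZr a f g : hl f (a *: g) = a * hl f g.
Proof. exact: (linearZ_LR (hl f)). Qed.

Lemma hlZl a f g : hl (a *: f) g = a * hl f g.
Proof. by rewrite hlC hlZr hlC. Qed.

Lemma hl_sumr I (r : seq I) (P : pred I) (F : I -> Sym) f :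
  hl f (\sum_(i <- r | P i) F i) = \sum_(i <- r | P i) hl f (F i).
Proof. exact: (linear_sum (hl f)). Qed.

Lemma hl_suml I (r : seq I) (P : pred I) (F : I -> Sym) f :
  hl (\sum_(i <- r | P i) F i) f = \sum_(i <- r | P i) hl (F i) f.
Proof. by rewrite hlC hl_sumr; apply: eq_bigr => i _; rewrite hlC. Qed.

Lemma hl_expand g f : hl g f = \sum_(m <- msupp g) g@_m * hl << m >> f.
Proof.
by rewrite {1}(malg_scaleE g) hl_suml; apply: eq_bigr => m _; rewrite hlZl.
Qed.

Lemma hl_mul_expand g x f :
  hl (x * g) f = \sum_(m <- msupp g) g@_m * hl (x * << m >>) f.
Proof.
rewrite {1}(malg_scaleE g) mulr_sumr hl_suml.
by apply: eq_bigr => m _; rewrite -scalerAr hlZl.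
Qed.

Lemma hl_homog n p f g : homog n f -> homog p g -> n != p -> hl f g = 0.
Proof.
move=> fn gp np; rewrite (malg_scaleE g) hl_sumr big1 // => m _.
rewrite hlZr hl_monom; have [mn|/fn ->] := eqVneq (wdeg m) n; last first.
  by rewrite mul0r mulr0.
by rewrite gp ?mul0r // mn.
Qed.

(** * Adjoints of multiplication by power sums and by complete symmetric functions *)

Definition slice (m : Mon) : Sym2 -> Sym :=
  linext (fun ab : (Mon * Mon)%type => (ab.1 == m)%:R *: << ab.2 >>).

Lemma mcoeff_slice m F n : (slice m F)@_n = F@_(m, n).
Proof.
rewrite /slice linextE [in RHS](malg_scaleE F) !raddf_sum /=.
apply: eq_bigr => -[a b] _; rewrite !mcoeffZ !mcoeffU /= xpair_eqE.
by congr (_ * _); case: (a == m); case: (b == n); rewrite /= ?mulr1 ?mul0r.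
Qed.

Lemma eps_slice m F : eps (slice m F) = (contr F)@_m.
Proof.
rewrite /slice /contr !linextE (linear_sum eps) raddf_sum /=.
apply: eq_bigr => -[a b] _; rewrite !(linearZ_LR eps) mcoeffZ /= mcoeff_U.
by rewrite /eps linextU mulr1.
Qed.

Lemma homog_slice m n f : homog n f ->
  forall k : Mon, (wdeg m + wdeg k)%N != n -> (slice m (delta f))@_k = 0.
Proof.
move=> fn k mkn; rewrite mcoeff_slice mcoeff_delta hl_monom fn ?wdegM //.
by rewrite !mul0r.
Qed.

(* [slice m (delta f)] is [p_m^⊥ f], up to the factor [z_m]. *)
Lemma hl_mulU g m f : hl (g * << m >>) f = (zmon m)%:R * hl g (slice m (delta f)).
Proof.
rewrite mulrC hl_mul_expand (hl_expand g) mulr_sumr; apply: eq_bigr => k _.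
rewrite mulrCA; congr (_ * _).
rewrite [hl _ (slice _ _)]hlC hl_monom mcoeff_slice mcoeff_delta.
by rewrite mulfVK ?zmon_neq0 // [RHS]mulrC mulfVK ?zmon_neq0 // hlC malgU_mul.
Qed.

Lemma hl_hs k G : homog k G -> hl (hs k) G = eps G.
Proof.
move=> Gk; rewrite epsE {1}(malg_scaleE G) hl_sumr; apply: eq_bigr => m _.
rewrite hlZr hl_monom mcoeff_hs mulfVK ?zmon_neq0 //.
by have [_|/Gk ->] := eqVneq (wdeg m) k; rewrite ?mulr1 ?mul0r.
Qed.

(** Moving p_m across the form leaves z_m times the pairing of h_k with the slice of [delta f] at m.
    In the right degree this pairing is [eps] of the slice ([hl_hs]), that is, the coefficient of
    p_m in [tau f]; in any other degree it is 0. *)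
Lemma hl_hsMU k n f m : homog n f ->
  hl (hs k * << m >>) f = (wdeg m + k == n)%:R * hl << m >> (tau f).
Proof.
move=> fn; rewrite hl_mulU [in RHS]hlC hl_monom -eps_slice.
have [mkn|mkn] := eqVneq (wdeg m + k)%N n.
  rewrite mul1r [RHS]mulrC hl_hs // => l lk; apply: (homog_slice fn).
  by rewrite -mkn eqn_add2l.
rewrite mul0r (hlC (hs k)) hl_expand big1 ?mulr0 // => l _.
rewrite hlC hl_monom mcoeff_hs.
case: eqP => [lk|_]; last by rewrite !mul0r mulr0.
by rewrite (homog_slice fn) ?mul0r // lk.
Qed.

Lemma sch_jt la : sch la = jt hs (size la) (part la).
Proof. by rewrite -sch_schur -hs_hsym. Qed.

Lemma hs0 : hs 0 = 1.
Proof. by rewrite -hs_hsym hsym0. Qed.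

Lemma tau_sch ga :
  tau (sch ga) = \sum_(be <- intpartns_le (psize ga) | hstrip ga be) sch be.
Proof.
rewrite sch_jt (rmorph_jt_hstrip hs0 tau_hs).
by apply: eq_bigr => be _; rewrite sch_jt.
Qed.

(** The adjoint Pieri rule: h_k^⊥ s_nu is the component of degree |nu| - k of [tau_sch], selected by
    the condition on [psize be]. *)
Lemma hl_hsM_sch k g nu :
  hl (hs k * g) (sch nu) =
  \sum_(be <- intpartns_le (psize nu) | hstrip nu be && (psize be + k == psize nu)%N)
     hl g (sch be).
Proof.
have U m : hl (hs k * << m >>) (sch nu) =
  \sum_(be <- intpartns_le (psize nu) | hstrip nu be && (psize be + k == psize nu)%N)
     hl << m >> (sch be).
  rewrite (hl_hsMU k m (homog_sch (la := nu))) tau_sch hl_sumr mulr_sumr [RHS]big_mkcondr.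
  apply: eq_bigr => be _; have [e|ne] := eqVneq (wdeg m) (psize be).
    by rewrite e; case: ifP; rewrite ?mul1r ?mul0r.
  by rewrite hlC hl_monom (homog_sch ne) mul0r mulr0 if_same.
rewrite hl_mul_expand.
rewrite [RHS](eq_bigr (fun be => \sum_(m <- msupp g) g@_m * hl << m >> (sch be))).
  by rewrite exchange_big; apply: eq_bigr => m _; rewrite U mulr_sumr.
by move=> be _; apply: hl_expand.
Qed.

(** * Orthonormality of the Schur functions *)

Lemma part_behead la : exists mu, forall i, part mu i = part la i.+1.
Proof.
have [mu e] := @part_exists (fun i => part la i.+1) (size la)
  (fun i => part_mono la (leqnSn _)) (part_ge0 (leqnSn _)).
by exists mu.
Qed.

Lemma psize_behead la mu : (forall i, part mu i = part la i.+1) ->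
  psize la = (part la 0 + psize mu)%N.
Proof.
move=> e; have sz : (size mu <= size la)%N.
  by rewrite leqNgt -part_gt0 e part_ge0 // leqnSn.
rewrite (psize_partw (leqnSn _)) (psize_partw sz) big_ord_recl.
by congr (_ + _)%N; apply: eq_bigr => i _; rewrite e.
Qed.

Lemma hstrip_behead la mu : (forall i, part mu i = part la i.+1) -> hstrip la mu.
Proof. by move=> e; apply/hstripP => i; rewrite e leqnn part_mono. Qed.

(** Laplace expansion along the first row. Deleting the first row and column raises both indices by
    1, which leaves la_(i+1) - i + j, the Jacobi-Trudi index of [mu]. *)
Lemma sch_expand_row (la mu : intpartn) : (0 < size la)%N -> (forall i, part mu i = part la i.+1) ->
  exists C : nat -> Sym, C 0%N = sch mu /\
    sch la = \sum_(j < size la) hs (part la 0 + j) * C j.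
Proof.
move=> la0 e; have sz : (size mu <= (size la).-1)%N.
  by rewrite leqNgt -part_gt0 e prednK // part_ge0.
rewrite !sch_jt -(jt_part hs0 sz) -(prednK la0); set l := (size la).-1.
rewrite /(jt _ l.+1); set A := (X in \det X).
exists (fun j => cofactor A ord0 (inord j)); split.
  rewrite (_ : inord 0 = ord0); last by apply: val_inj; rewrite /= inordK.
  rewrite /cofactor /jt expr0 mul1r; congr determinant; apply/matrixP => i j.
  rewrite !mxE /= /bump /= !add1n e /hz addnS ltnS subSS.
  by [].
rewrite (expand_det_row _ ord0); apply: eq_bigr => j _.
by rewrite inord_val !mxE /= /hz leq0n subn0.
Qed.

Lemma hl_sch_wlog la mu : psize la = psize mu -> (part mu 0 <= part la 0)%N ->
  (forall la' mu', (psize la' < psize la)%N ->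
     hl (sch la') (sch mu') = (la' == mu')%:R) ->
  hl (sch la) (sch mu) = (la == mu)%:R.
Proof.
move=> szE mula IH.
have [la0|la0] := posnP (size la).
  have p0 : psize la = 0%N by rewrite psize_part la0 big_ord0.
  have mu0 : size mu = 0%N.
    by apply/eqP; rewrite -leqn0 -p0 szE; apply: size_partn_le; case/andP: (valP mu).
  have -> : la = mu by apply: part_inj => i; rewrite !part_ge0 ?la0 ?mu0.
  rewrite eqxx sch_jt mu0 /jt det_mx00.
  have e1 : (1 : Sym) = << mone >> by [].
  by rewrite e1 hl_monom mcoeff_U eqxx zmon1 mul1r.
have [la' la'E] := part_behead la; have [mu' mu'E] := part_behead mu.
have [C [C0 ->]] := sch_expand_row la0 la'E.
have inner j : \sum_(be <- intpartns_le (psize mu) |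
     hstrip mu be && (psize be + (part la 0 + j) == psize mu)%N) hl (C j) (sch be)
   = ((j == 0%N) && (part la 0 == part mu 0))%:R * hl (sch la') (sch mu').
  (* A horizontal strip in mu has at most mu_0 <= la_0 cells, so one with la_0 + j cells forces j =
     0 and la_0 = mu_0; being of maximal size, it leaves [mu'] by [hstrip_first_row]. *)
  have cond be : hstrip mu be && (psize be + (part la 0 + j) == psize mu)%N =
      [&& j == 0%N, part la 0 == part mu 0 & be == mu'].
    apply/andP/and3P => [[mb /eqP sb]|[/eqP-> /eqP-> /eqP->]]; last first.
      by rewrite hstrip_behead // (psize_behead mu'E) addn0 addnC.
    have le : (part la 0 + j <= part mu 0)%N.
      by rewrite -(leq_add2l (psize be)) sb leq_psize_hstrip.
    have j0 : j = 0%N.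
      apply/eqP; rewrite -leqn0 -(leq_add2l (part la 0)) addn0.
      exact: leq_trans le mula.
    have lamu : part la 0 = part mu 0.
      by apply/eqP; rewrite eqn_leq mula andbT (leq_trans (leq_addr _ _) le).
    split; rewrite ?j0 ?lamu //; apply/eqP/part_inj => i; rewrite mu'E.
    by apply: hstrip_first_row => //; rewrite -sb j0 lamu addn0.
  rewrite (eq_bigl _ _ cond).
  case: (j =P 0%N) => [->|_] /=; last by rewrite big_pred0_eq mul0r.
  case: (_ == _) => /=; last by rewrite big_pred0_eq mul0r.
  rewrite mul1r -big_filter (_ : [seq _ <- _ | _] = [:: mu']) ?big_seq1 ?C0 //.
  apply: filter_pred1_uniq; first exact: uniq_intpartns_le.
  by rewrite mem_intpartns_le (psize_behead mu'E) leq_addl.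
rewrite hl_suml (eq_bigr (fun j : 'I_(size la) =>
    ((j == 0%N :> nat) && (part la 0 == part mu 0))%:R * hl (sch la') (sch mu'))).
  2: by move=> j _; rewrite hl_hsM_sch inner.
rewrite (bigD1 (Ordinal la0)) //= big1 ?addr0 => [|j]; last first.
  by rewrite -val_eqE /= => /negPf ->; rewrite mul0r.
rewrite IH; last first.
  by rewrite (psize_behead la'E) -[X in (X < _)%N]add0n ltn_add2r part_gt0.
rewrite -natrM mulnb; congr (nat_of_bool _)%:R.
apply/andP/eqP => [[/eqP e0 /eqP e']|lamu].
  by apply: part_inj => -[|i] //; rewrite -la'E -mu'E e'.
rewrite lamu !eqxx; split=> //; apply/eqP/part_inj => i.
by rewrite mu'E -lamu -la'E.
Qed.

Theorem hl_sch la mu : hl (sch la) (sch mu) = (la == mu)%:R.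
Proof.
have [n] := ubnP (psize la); elim: n la mu => // n IHn la mu lan.
have [szE|szN] := eqVneq (psize la) (psize mu); last first.
  rewrite (hl_homog (homog_sch (la := la)) (homog_sch (la := mu)) szN).
  by have [e|//] := eqVneq la mu; rewrite e eqxx in szN.
have IH la' mu' : (psize la' < psize la)%N -> hl (sch la') (sch mu') = (la' == mu')%:R.
  by move=> lt; apply: IHn; apply: leq_trans lt _.
have [le|le] := leqP (part mu 0) (part la 0); first exact: hl_sch_wlog.
by rewrite hlC eq_sym; apply: hl_sch_wlog; rewrite -?szE // ltnW.
Qed.

(** Orthonormality of the s_la says A B = 1 for square matrices indexed by the partitions of n; the
    claim is B A = 1. *)
Lemma sch_second_orth n ga de : ga \in intpartns n -> de \in intpartns n ->
  \sum_(la <- intpartns n)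
     hl (sch la) << monp ga >> * hl (sch la) << monp de >> / (zee de)%:R
  = (ga == de)%:R.
Proof.
set r := intpartns n; pose p i := tnth (in_tuple r) i => gar der.
have p_inj : injective p by apply/tuple_uniqP/uniq_intpartns.
have psz i : psize (p i) = n by apply/eqP; rewrite -mem_intpartns mem_tnth.
pose A := \matrix_(i, j) hl (sch (p i)) << monp (p j) >>.
pose B := \matrix_(j, i) (hl (sch (p i)) << monp (p j) >> / (zee (p j))%:R).
have AB : A *m B = 1%:M.
  apply/matrixP => i k; rewrite !mxE -(inj_eq p_inj) -hl_sch.
  rewrite {1}(homog_expand (homog_sch (la := p k))) psz hl_sumr [RHS]big_tnth.
  by apply: eq_bigr => j _; rewrite !mxE hlZr mulrC.
have [[j ->] [k ->]] := (tnthP (in_tuple r) ga gar, tnthP (in_tuple r) de der).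
have := congr1 (fun M : 'M_(size r) => M k j) (mulmx1C AB).
rewrite !mxE eq_sym -(inj_eq p_inj) => <-.
rewrite [LHS]big_tnth; apply: eq_bigr => i _.
by rewrite !mxE [RHS]mulrC mulrA.
Qed.

Lemma sch_expandU m :
  << m >> = \sum_(la <- intpartns (wdeg m)) hl (sch la) << m >> *: sch la.
Proof.
apply/malgP => k; rewrite raddf_sum /=.
have [e|ne] := eqVneq (wdeg k) (wdeg m); last first.
  rewrite mcoeffU; have [mk|_] := eqVneq m k; first by rewrite mk eqxx in ne.
  rewrite big_seq big1 // => la; rewrite mem_intpartns => /eqP lam.
  by rewrite mcoeffZ (homog_sch (la := la)) ?mulr0 // lam.
have [ga gaE] := monp_surj m; have [de deE] := monp_surj k.
have gan : ga \in intpartns (wdeg m) by rewrite mem_intpartns -gaE wdeg_monp.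
have den : de \in intpartns (wdeg m) by rewrite mem_intpartns -e -deE wdeg_monp.
rewrite mcoeffU -[in LHS]gaE -[in LHS]deE (inj_eq monp_inj).
rewrite -(sch_second_orth gan den); apply: eq_bigr => la _.
rewrite mcoeffZ gaE deE -mulrA; congr (_ * _).
by rewrite hl_monom -zmon_monp deE mulfK ?zmon_neq0.
Qed.

Lemma big_intpartns_le (V : zmodType) N d (F : intpartn -> V) : (d <= N)%N ->
  (forall al, psize al != d -> F al = 0) ->
  \sum_(al <- intpartns_le N) F al = \sum_(al <- intpartns d) F al.
Proof.
move=> dN F0; rewrite (bigID (fun al => psize al == d)) /= [X in _ + X]big1 //.
rewrite addr0 -big_filter; apply/perm_big/uniq_perm.
- exact/filter_uniq/uniq_intpartns_le.
- exact: uniq_intpartns.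
move=> al; rewrite mem_filter mem_intpartns_le mem_intpartns.
by case: eqP => // ->.
Qed.

(** The coefficient of p_m ⊗ p_n on the left is <p_m p_n, s_la> / (z_m z_n). Expanding p_m and p_n
    by [sch_expandU] turns it into a sum of <s_al s_ga, s_la> times the coefficients of p_m in s_al
    and of p_n in s_ga. *)
Lemma delta_sch la : delta (sch la) =
  \sum_(al <- intpartns_le (psize la)) \sum_(ga <- intpartns (psize la - psize al))
     hl (sch al * sch ga) (sch la) *: tn (sch al) (sch ga).
Proof.
apply/malgP => -[m n]; rewrite mcoeff_delta raddf_sum /=.
pose G al ga := hl (sch al * sch ga) (sch la) * ((sch al)@_m * (sch ga)@_n).
have -> : \sum_(al <- intpartns_le (psize la)) (\sum_(ga <- intpartns (psize la - psize al))
     hl (sch al * sch ga) (sch la) *: tn (sch al) (sch ga))@_(m, n) =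
   \sum_(al <- intpartns_le (psize la)) \sum_(ga <- intpartns (psize la - psize al)) G al ga.
  apply: eq_bigr => al _; rewrite raddf_sum /=.
  by apply: eq_bigr => ga _; rewrite mcoeffZ tnE.
have G0 al ga : psize al != wdeg m -> G al ga = 0.
  by rewrite eq_sym /G => /(homog_sch (la := al)) ->; rewrite mul0r mulr0.
have [e|ne] := eqVneq (wdeg m + wdeg n)%N (psize la); last first.
  rewrite hl_monom (homog_sch (la := la)) ?wdegM // !mul0r.
  rewrite big_seq big1 // => al; rewrite mem_intpartns_le => alN.
  have [am|/G0 am] := eqVneq (psize al) (wdeg m); last by apply: big1.
  rewrite big_seq big1 // => ga; rewrite mem_intpartns => /eqP gaN.
  rewrite /G (homog_sch (la := ga)) ?mulr0 // gaN.
  by apply: contraNneq ne => ->; rewrite -am subnKC.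
rewrite (@big_intpartns_le _ _ (wdeg m)) -?e ?leq_addr //; last first.
  by move=> al /G0 am; apply: big1.
rewrite malgU_mul hlC [X in hl (X * _)](sch_expandU m) mulr_suml hl_suml.
rewrite !mulr_suml big_seq [RHS]big_seq; apply: eq_bigr => al.
rewrite mem_intpartns => /eqP ->; rewrite addKn.
rewrite [X in hl (_ * X)](sch_expandU n) mulr_sumr hl_suml !mulr_suml.
apply: eq_bigr => ga _; rewrite -scalerAl -scalerAr !hlZl !hl_monom /G.
have cancel (a b c x y : rat) : x != 0 -> y != 0 ->
  a * x * (b * y * c) / x / y = c * (a * b) by move=> x0 y0; field; apply/andP.
by apply: cancel; apply: zmon_neq0.
Qed.

(** * The deformed power sums *)

Lemma prod_ucmM (R : comNzRingType) (F : nat -> nat -> R) x i (m : Mon) N : (i < N)%N ->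
  F i (m i).+1 = x * F i (m i) ->
  \prod_(j < N) F j (mmul (ucm i) m j) = x * \prod_(j < N) F j (m j).
Proof.
move=> iN FS; rewrite (bigD1 (Ordinal iN)) //= [in RHS](bigD1 (Ordinal iN)) //=.
rewrite cmM cmUU add1n FS -mulrA; congr (_ * (_ * _)); apply: eq_bigr => j.
by rewrite -val_eqE cmM cmU eq_sym => /negPf ->.
Qed.

Lemma prod_psE (m : Mon) N : (forall i, m i != 0%N -> (i < N)%N) ->
  << m >> = \prod_(i < N) ps i.+1 ^+ m i.
Proof.
elim/Mon_ind: m => [|i m IHm] mN.
  by rewrite big1 // => i _; rewrite cm1.
have iN : (i < N)%N by apply: mN; rewrite cmM cmUU.
have mN' j : m j != 0%N -> (j < N)%N.
  by move=> mj; apply: mN; rewrite cmM addn_eq0 negb_and mj orbT.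
rewrite malgU_mul -(ps_U i) (IHm mN').
by rewrite (prod_ucmM (F := fun j k => ps j.+1 ^+ k) iN (exprS _ _)).
Qed.

Lemma Sym_morph_ext (A : comAlgType rat) (F G : {lrmorphism Sym -> A}) :
  (forall k, F (ps k.+1) = G (ps k.+1)) -> F =1 G.
Proof.
move=> FG; apply: malg_linear_ext => m.
elim/Mon_ind: m => [|i m IHm]; first by rewrite !rmorph1.
by rewrite malgU_mul -(ps_U i) !rmorphM /= IHm FG.
Qed.

Definition sigma_mon (m : Mon) : Sym := \prod_(i <- finsupp m) (ps i.+1 - 1) ^+ m i.

Lemma sigma_monE (m : Mon) N : (forall i, m i != 0%N -> (i < N)%N) ->
  sigma_mon m = \prod_(i < N) (ps i.+1 - 1) ^+ m i.
Proof. by move=> mN; apply: big_finsupp => // i ->. Qed.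

Definition sigma : Sym -> Sym := linext sigma_mon.

Lemma sigma_is_linear : linear sigma.
Proof. exact: linext_is_linear. Qed.

HB.instance Definition _ :=
  GRing.isLinear.Build rat Sym Sym *:%R sigma sigma_is_linear.

Lemma sigma_is_multiplicative : multiplicative sigma.
Proof.
split; last by rewrite /sigma linextU /sigma_mon mdom1 big_seq_fset0.
apply: linextM => m n.
have [M mM] := supp_bound m; have [N nN] := supp_bound n.
have [k1 k2] := (leq_maxl M N, leq_maxr M N).
have mB i : m i != 0%N -> (i < maxn M N)%N by move=> /mM h; apply: leq_trans h k1.
have nB i : n i != 0%N -> (i < maxn M N)%N by move=> /nN h; apply: leq_trans h k2.
rewrite (sigma_monE mB) (sigma_monE nB) (@sigma_monE _ (maxn M N)) => [|i].
  by rewrite -big_split /=; apply: eq_bigr => i _; rewrite cmM exprD.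
by rewrite cmM addn_eq0 negb_and => /orP[/mB|/nB].
Qed.

HB.instance Definition _ := GRing.isMultiplicative.Build Sym Sym sigma
  sigma_is_multiplicative.

Lemma sigma_ps k : sigma (ps k.+1) = ps k.+1 - 1.
Proof.
by rewrite {1}ps_U /sigma linextU /sigma_mon mdomU big_seq_fset1 cmUU expr1.
Qed.

Lemma tauK : cancel tau sigma.
Proof.
pose F : {lrmorphism Sym -> Sym} := (sigma \o tau : Sym -> Sym).
apply: (@Sym_morph_ext _ F idfun) => k.
by rewrite /= tau_ps // (linearD sigma) /= sigma_ps (rmorph1 sigma) subrK.
Qed.

Lemma sigmaK : cancel sigma tau.
Proof.
pose F : {lrmorphism Sym -> Sym} := (tau \o sigma : Sym -> Sym).
apply: (@Sym_morph_ext _ F idfun) => k.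
by rewrite /= sigma_ps (linearB tau) /= tau_ps // (rmorph1 tau) addrK.
Qed.

Definition tmap (F G : Sym -> Sym) : Sym2 -> Sym2 :=
  linext (fun mn : (Mon * Mon)%type => tn (F << mn.1 >>) (G << mn.2 >>)).

Lemma tmap_is_linear F G : linear (tmap F G).
Proof. exact: linext_is_linear. Qed.

HB.instance Definition _ F G :=
  GRing.isLinear.Build rat Sym2 Sym2 *:%R (tmap F G) (tmap_is_linear F G).

Lemma tmapU F G m n : tmap F G << (m, n) >> = tn (F << m >>) (G << n >>).
Proof. exact: linextU. Qed.

Lemma tmap_tn (F G : {linear Sym -> Sym}) f g : tmap F G (tn f g) = tn (F f) (G g).
Proof.
rewrite tn_scaleE (linear_sum (tmap F G)) /=.
rewrite [in RHS](malg_scaleE f) (linear_sum F) tn_suml; apply: eq_bigr => m _.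
rewrite [in RHS](malg_scaleE g) (linear_sum G) (linear_sum (tmap F G)) tn_sumr /=.
apply: eq_bigr => n _; rewrite (linearZ_LR (tmap F G)) (linearZ_LR F) /=.
by rewrite (linearZ_LR G) tnZl tnZr tmapU scalerA.
Qed.

Lemma tmapM (F G : {lrmorphism Sym -> Sym}) : {morph tmap F G : f g / f * g}.
Proof.
apply: linextM => -[a b] [c d] /=.
by rewrite !malgU_mul !rmorphM tnM.
Qed.

Lemma tnBl f f' g : tn (f - f') g = tn f g - tn f' g.
Proof. exact: (linearB (tnl g)). Qed.

(** Both sides are algebra morphisms, and on p_k the constant -1 = -(1 ⊗ 1) can be absorbed into the
    left factor. *)
Lemma delta_sigma f : delta (sigma f) = tmap sigma idfun (delta f).
Proof.
have L1 : linear (tmap sigma idfun \o delta).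
  by move=> a x y; rewrite /= (linearP delta) (linearP (tmap _ _)).
have M1 : multiplicative (tmap sigma idfun \o delta).
  split=> [x y|] /=; first by rewrite (rmorphM delta) tmapM.
  by rewrite (rmorph1 delta) -tn11 tmap_tn rmorph1.
pose aux := HB.pack_for {lrmorphism Sym -> Sym2} (tmap sigma idfun \o delta)
  (GRing.isLinear.Build rat Sym Sym2 *:%R _ L1)
  (GRing.isMultiplicative.Build Sym Sym2 _ M1).
pose F : {lrmorphism Sym -> Sym2} := (delta \o sigma : Sym -> Sym2).
apply: (@Sym_morph_ext _ F aux) => k.
rewrite /= sigma_ps (linearB delta) /= rmorph1 !delta_ps //.
rewrite (linearD (tmap _ _)) /= !tmap_tn /= sigma_ps rmorph1.
by rewrite -tn11 tnBl addrAC.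
Qed.

(** Meant for [Phi0] and [tmap Phi0 Phi0]: they are not multiplicative, but they respect products
    with one factor for each index i. Multiplying out a product of sums gives only such products. *)
Lemma linear_prod_sum (V W : comAlgType rat) (L : {linear V -> W}) N (J : finType)
    (c : 'I_N -> J -> rat) (u : 'I_N -> J -> V) (w : 'I_N -> J -> W) :
  (forall f : {ffun 'I_N -> J}, L (\prod_i u i (f i)) = \prod_i w i (f i)) ->
  L (\prod_i \sum_j c i j *: u i j) = \prod_i \sum_j c i j *: w i j.
Proof.
move=> Lu; rewrite !bigA_distr_bigA (linear_sum L); apply: eq_bigr => f _ /=.
by rewrite !scaler_prod (linearZ_LR L) Lu.
Qed.

Section FallingFactorial.
Variable R : comNzRingType.
Implicit Types x y : R.

Lemma falling0 x : falling x 0 = 1.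
Proof. by rewrite /falling big_ord0. Qed.

Lemma fallingS x r : falling x r.+1 = falling x r * (x - r%:R).
Proof. by rewrite /falling big_ord_recr. Qed.

(** Vandermonde's identity, by induction: the new factor is x + y - n = (x - k) + (y - (n - k)), and
    Pascal's rule recombines the two sums. *)
Lemma fallingD x y n :
  falling (x + y) n = \sum_(k < n.+1) 'C(n, k)%:R * (falling x k * falling y (n - k)).
Proof.
elim: n => [|n IHn]; first by rewrite big_ord_recl big_ord0 !falling0 bin0 !mul1r addr0.
rewrite fallingS IHn mulr_suml.
pose X k := falling x k; pose Y k := falling y k.
transitivity (\sum_(k < n.+1) 'C(n, k)%:R * (X k.+1 * Y (n - k)%N) +
              \sum_(k < n.+1) 'C(n, k)%:R * (X k * Y (n - k).+1)).
  rewrite -big_split; apply: eq_bigr => k _ /=; rewrite /X /Y !fallingS.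
  have -> : n%:R = k%:R + (n - k)%:R :> R.
    by rewrite -natrD subnKC // -ltnS.
  move: ('C(n, k)%:R) (falling x k) (falling y _) (k%:R) ((n - k)%:R) => *.
  ring.
rewrite [X in _ + X]big_ord_recl [RHS]big_ord_recl !bin0 !subn0 addrCA.
congr (_ + _).
rewrite [RHS](eq_bigr (fun k : 'I_n.+1 => 'C(n, k)%:R * (X k.+1 * Y (n - k)%N) +
    'C(n, k.+1)%:R * (X k.+1 * Y (n - k)%N))); last first.
  by move=> k _; rewrite lift0 binS natrD mulrDl subSS addrC.
rewrite [RHS]big_split; congr (_ + _).
rewrite [RHS]big_ord_recr /= bin_small // mul0r addr0.
by apply: eq_bigr => k _; rewrite /bump /= ?add1n subnSK.
Qed.

Lemma fallingM_morph (S : comNzRingType) (F : {rmorphism R -> S}) x n :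
  F (falling x n) = falling (F x) n.
Proof.
rewrite /falling rmorph_prod; apply: eq_bigr => k _.
by rewrite rmorphB rmorph_nat.
Qed.

End FallingFactorial.

Lemma tnl1_is_multiplicative : multiplicative (tnl 1).
Proof. by split=> [f g|]; rewrite /tnl ?tn11 // tnM mulr1. Qed.

HB.instance Definition _ := GRing.isMultiplicative.Build Sym Sym2 (tnl 1)
  tnl1_is_multiplicative.

Lemma tn1_is_multiplicative : multiplicative (tn 1).
Proof. by split=> [f g|]; rewrite ?tn11 // tnM mulr1. Qed.

HB.instance Definition _ := GRing.isMultiplicative.Build Sym Sym2 (tn 1)
  tn1_is_multiplicative.

Fact qs_key : unit. Proof. by []. Qed.
Fact pb_key : unit. Proof. by []. Qed.

Definition qs : nat -> Sym := locked_with qs_key qsym.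
Definition pb : nat -> nat -> Sym := locked_with pb_key pbar.

Lemma qs_qsym : qsym = qs. Proof. by rewrite /qs unlock. Qed.
Lemma pb_pbar : pbar = pb. Proof. by rewrite /pb unlock. Qed.

Lemma qsE i : qs i = i%:R^-1 *: \sum_(d <- divisors i) mob (i %/ d) *: ps d.
Proof. by rewrite -qs_qsym -ps_psum. Qed.

Lemma pbE i r : pb i r = (i ^ r)%:R *: falling (qs i) r.
Proof. by rewrite -pb_pbar /pbar qs_qsym -scaler_nat -scalerAl mul1r. Qed.

Lemma pb0 i : pb i 0 = 1.
Proof. by rewrite pbE falling0 expn0 scale1r. Qed.

Lemma delta_qs i : (0 < i)%N -> delta (qs i) = tn (qs i) 1 + tn 1 (qs i).
Proof.
move=> i0; rewrite qsE (linearZ_LR delta) (linear_sum delta) tnZl tnZr.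
rewrite tn_suml tn_sumr -scalerDr -big_split /=; congr (_ *: _).
rewrite big_seq [RHS]big_seq; apply: eq_bigr => d.
rewrite -dvdn_divisors // => di; have d0 := dvdn_gt0 i0 di.
by rewrite (linearZ_LR delta) /= delta_ps // tnZl tnZr scalerDr.
Qed.

Lemma falling_tnl x n : falling (tn x 1) n = tn (falling x n) 1.
Proof. exact: (esym (fallingM_morph (tnl 1) x n)). Qed.

Lemma falling_tnr x n : falling (tn 1 x) n = tn 1 (falling x n).
Proof. exact: (esym (fallingM_morph (tn 1) x n)). Qed.

Lemma natr_scale (A : lalgType rat) (n : nat) (x : A) : n%:R * x = (n%:R : rat) *: x.
Proof. by rewrite mulr_natl scaler_nat. Qed.

Lemma tn_mul1 f g : tn f 1 * tn 1 g = tn f g.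
Proof. by rewrite tnM mulr1 mul1r. Qed.

Lemma tn_scale2 a b f g : tn (a *: f) (b *: g) = (a * b) *: tn f g.
Proof. by rewrite tnZl tnZr scalerA. Qed.

Lemma delta_pb i n : (0 < i)%N ->
  delta (pb i n) = \sum_(k < n.+1) 'C(n, k)%:R *: tn (pb i k) (pb i (n - k)).
Proof.
move=> i0; rewrite pbE (linearZ_LR delta) /= (fallingM_morph delta) /= delta_qs //.
rewrite fallingD scaler_sumr; apply: eq_bigr => k _.
rewrite natr_scale (falling_tnl (qs i) k) (falling_tnr (qs i) (n - k)) tn_mul1.
rewrite (pbE i k) (pbE i (n - k)) tn_scale2 !scalerA.
have -> : (i ^ n)%:R * 'C(n, k)%:R = 'C(n, k)%:R * ((i ^ k)%:R * (i ^ (n - k))%:R) :> rat.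
  by rewrite -!natrM mulnC -expnD subnKC // -ltnS.
by [].
Qed.

(* [Phi0] is p_ga |-> \overline{p}_ga, and [Phi] below is p_ga |-> \mathbf{p}_ga. *)
Definition Phi0_mon (m : Mon) : Sym := \prod_(i <- finsupp m) pb i.+1 (m i).

Lemma Phi0_monE (m : Mon) N : (forall i, m i != 0%N -> (i < N)%N) ->
  Phi0_mon m = \prod_(i < N) pb i.+1 (m i).
Proof. by move=> mN; apply: big_finsupp => // i ->; apply: pb0. Qed.

Definition Phi0 : Sym -> Sym := linext Phi0_mon.

Lemma Phi0_is_linear : linear Phi0.
Proof. exact: linext_is_linear. Qed.

HB.instance Definition _ :=
  GRing.isLinear.Build rat Sym Sym *:%R Phi0 Phi0_is_linear.

Lemma Phi0U m : Phi0 << m >> = Phi0_mon m.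
Proof. exact: linextU. Qed.

Lemma Phi0_prod N (f : 'I_N -> nat) :
  Phi0 (\prod_(i < N) ps i.+1 ^+ f i) = \prod_(i < N) pb i.+1 (f i).
Proof.
(* Extension of the exponents by 0, which makes the product on the left a genuine monomial [m]. *)
pose g i := if insub i is Some j then f j else 0%N.
pose m : Mon := [cmonom g i | i in [fset i in iota 0 N]%fset]%M.
have mE i : m i = g i.
  rewrite /m cmE fsfun_fun in_fset /= mem_iota add0n /g.
  by case: ltnP => // iN; rewrite insubF // ltnNge iN.
have mN i : m i != 0%N -> (i < N)%N by rewrite mE /g; case: insubP => //= j ->.
have mf (i : 'I_N) : m i = f i by rewrite mE /g valK.
transitivity (Phi0 << m >>).
  by congr Phi0; rewrite (prod_psE mN); apply: eq_bigr => i _; rewrite mf.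
by rewrite Phi0U (Phi0_monE mN); apply: eq_bigr => i _; rewrite mf.
Qed.

(** On a monomial, [delta_pb] and the binomial theorem for p_i ⊗ 1 + 1 ⊗ p_i give products of sums
    with the same binomial coefficients, and [linear_prod_sum] matches them. *)
Lemma delta_Phi0 f : delta (Phi0 f) = tmap Phi0 Phi0 (delta f).
Proof.
apply: (@linear_ext _ _ (fun f => delta (Phi0 f))
  (fun f => tmap Phi0 Phi0 (delta f))).
- by move=> a x y; rewrite (linearP Phi0) (linearP delta).
- by move=> a x y; rewrite (linearP delta) (linearP (tmap _ _)).
move=> m /=.
have [N mN] := supp_bound m.
(* A common bound gives all inner sums the same index type; the added terms have binomial
   coefficient 0. *)
have [B mB] : exists B, forall i, (m i <= B)%N.
  exists (\max_(i < N) m i) => i; have [->//|/mN iN] := eqVneq (m i) 0%N.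
  exact: (leq_bigmax (Ordinal iN)).
pose c (i : 'I_N) (k : 'I_B.+1) : rat := 'C(m i, k)%:R.
have widen (V : lmodType rat) (i : 'I_N) (x : nat -> V) :
    \sum_(k < (m i).+1) 'C(m i, k)%:R *: x k = \sum_(k < B.+1) c i k *: x k.
  rewrite (big_ord_widen _ (fun k => ('C(m i, k)%:R : rat) *: x k) (mB i : (m i < B.+1)%N)).
  rewrite big_mkcond; apply: eq_bigr => k _; rewrite /c; case: ltnP => // mk.
  by rewrite bin_small // scale0r.
rewrite Phi0U (Phi0_monE mN) (rmorph_prod delta) (prod_psE mN) (rmorph_prod delta).
rewrite [LHS](eq_bigr (fun i : 'I_N => \sum_(k < B.+1) c i k *:
    tn (pb i.+1 k) (pb i.+1 (m i - k)))); last first.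
  by move=> i _; rewrite [LHS]delta_pb // (widen _ _ (fun k => tn (pb i.+1 k) (pb i.+1 (m i - k)))).
rewrite [X in tmap _ _ X](eq_bigr (fun i : 'I_N => \sum_(k < B.+1) c i k *:
    tn (ps i.+1 ^+ k) (ps i.+1 ^+ (m i - k)))); last first.
  move=> i _; rewrite /= (rmorphXn delta) /= delta_ps // addrC exprDn.
  rewrite -(widen _ _ (fun k => tn (ps i.+1 ^+ k) (ps i.+1 ^+ (m i - k)))).
  apply: eq_bigr => k _; rewrite scaler_nat; congr (_ *+ _).
  by rewrite -(rmorphXn (tn 1)) -(rmorphXn (tnl 1)) /= mulrC tn_mul1.
apply/esym/linear_prod_sum => g.
have tn_prod (x y : 'I_N -> Sym) : \prod_i tn (x i) (y i) = tn (\prod_i x i) (\prod_i y i).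
  elim/big_rec3: _ => [|i a b z _ ->]; [by rewrite tn11 | by rewrite tnM].
rewrite /= !tn_prod tmap_tn /=.
by rewrite (Phi0_prod (fun i => g i)) (Phi0_prod (fun i => m i - g i)%N).
Qed.

Definition Phi (f : Sym) : Sym := Phi0 (sigma f).

Lemma Phi_is_linear : linear Phi.
Proof. by move=> a f g; rewrite /Phi (linearP sigma) (linearP Phi0). Qed.

HB.instance Definition _ :=
  GRing.isLinear.Build rat Sym Sym *:%R Phi Phi_is_linear.

Fact pt_key : unit. Proof. by []. Qed.
Definition pt : nat -> nat -> Sym := locked_with pt_key ptil.

Lemma pt_ptil : ptil = pt. Proof. by rewrite /pt unlock. Qed.

Lemma ptE i r :
  pt i r = \sum_(k < r.+1) ((-1) ^+ (r - k) * 'C(r, k)%:R) *: pb i k.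
Proof.
rewrite -pt_ptil /ptil pb_pbar; apply: eq_bigr => k _.
move: (pb i k) => x; rewrite -mulrA natr_scale -signr_odd -[in RHS]signr_odd.
case: (odd _); rewrite ?expr0 ?expr1 ?mul1r //.
by rewrite !mulN1r scaleNr.
Qed.

Lemma pt0 i : pt i 0 = 1.
Proof. by rewrite ptE big_ord1 bin0 subnn expr0 mulr1 scale1r pb0. Qed.

(** Expanding each (p_i - 1)^r binomially and replacing p_i^k by [pb i k] yields the alternating sum
    that defines \mathbf{p}_(i^r). *)
Lemma PhiU (m : Mon) : Phi << m >> = \prod_(i <- finsupp m) pt i.+1 (m i).
Proof.
have [N mN] := supp_bound m.
have [B mB] : exists B, forall i, (m i <= B)%N.
  exists (\max_(i < N) m i) => i; have [->//|/mN iN] := eqVneq (m i) 0%N.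
  exact: (leq_bigmax (Ordinal iN)).
pose c (i : 'I_N) (k : 'I_B.+1) : rat := (-1) ^+ (m i - k) * 'C(m i, k)%:R.
have widen (V : lmodType rat) (i : 'I_N) (x : nat -> V) :
    \sum_(k < (m i).+1) ((-1) ^+ (m i - k) * 'C(m i, k)%:R) *: x k =
    \sum_(k < B.+1) c i k *: x k.
  rewrite (big_ord_widen _ (fun k => ((-1) ^+ (m i - k) * 'C(m i, k)%:R : rat) *: x k)
    (mB i : (m i < B.+1)%N)).
  rewrite big_mkcond; apply: eq_bigr => k _; rewrite /c; case: ltnP => // mk.
  by rewrite bin_small // mulr0 scale0r.
have -> : \prod_(i <- finsupp m) pt i.+1 (m i) = \prod_(i < N) pt i.+1 (m i).
  by apply: big_finsupp => // i ->; apply: pt0.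
rewrite [RHS](eq_bigr (fun i : 'I_N => \sum_(k < B.+1) c i k *: pb i.+1 k)); last first.
  by move=> i _; rewrite ptE (widen _ _ (fun k => pb i.+1 k)).
rewrite /Phi [sigma _]linextU (sigma_monE mN).
rewrite [X in Phi0 X](eq_bigr (fun i : 'I_N => \sum_(k < B.+1) c i k *: ps i.+1 ^+ k)).
  by apply: linear_prod_sum => f; apply: (Phi0_prod (fun i => f i)).
move=> i _; rewrite -(widen _ _ (fun k => ps i.+1 ^+ k)) addrC exprDn.
apply: eq_bigr => k _; move: (ps i.+1 ^+ k) => x.
rewrite -mulr_natl natr_scale [in RHS]mulrC -[RHS]scalerA; congr (_ *: _).
rewrite -[in LHS]signr_odd -[in RHS]signr_odd.
by case: (odd _); rewrite ?expr0 ?expr1 ?mul1r ?scale1r ?mulN1r ?scaleN1r.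
Qed.

Lemma ptilp_Phi ga : ptilp ga = Phi << monp ga >>.
Proof.
rewrite PhiU (eq_bigr (fun i => pt i.+1 (mult ga i.+1))).
  2: by move=> i _; rewrite monpE.
rewrite /ptilp pt_ptil -(big_map S xpredT (fun i => pt i (mult ga i))).
apply/perm_big/uniq_perm.
- exact: undup_uniq.
- by rewrite (map_inj_uniq succn_inj) fset_uniq.
move=> i; rewrite mem_undup; case: i => [|i].
  have /andP[_ /negPf ->] := valP ga.
  by symmetry; apply/negP => /mapP[].
by rewrite (mem_map succn_inj) -cmE_neq0 monpE -lt0n -has_count has_pred1.
Qed.

Lemma stil_Phi la : stil la = Phi (sch la).
Proof.
rewrite [in RHS](homog_expand (homog_sch (la := la))) (linear_sum Phi) /=.
rewrite /stil; apply: eq_bigr => ga _.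
by rewrite (linearZ_LR Phi) /chi hl_hall sch_schur psumpE ptilp_Phi.
Qed.

(** Since [sigma] inverts [tau], [Phi0] is [Phi] after [tau], and the Pieri rule [tau_sch]
    applies. *)
Lemma Phi0_sch ga : Phi0 (sch ga) =
  \sum_(be <- intpartns_le (psize ga) | hstrip ga be) Phi (sch be).
Proof. by rewrite -[in LHS](tauK (sch ga)) -/(Phi _) tau_sch (linear_sum Phi). Qed.

Lemma tmap_sigma_tn f g : tmap Phi0 Phi0 (tmap sigma idfun (tn f g)) = tn (Phi f) (Phi0 g).
Proof. by rewrite !tmap_tn. Qed.

Lemma LRcoefE la al ga : LRcoef la al ga = hl (sch al * sch ga) (sch la).
Proof. by rewrite /LRcoef hl_hall sch_schur. Qed.

Theorem delta_Phi_sch la : delta (Phi (sch la)) =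
  \sum_(al <- intpartns_le (psize la))
    \sum_(ga <- intpartns (psize la - psize al))
      \sum_(be <- intpartns_le (psize ga) | hstrip ga be)
        hl (sch al * sch ga) (sch la) *: tn (Phi (sch al)) (Phi (sch be)).
Proof.
rewrite /Phi delta_Phi0 delta_sigma delta_sch -!/(Phi _).
rewrite (linear_sum (tmap _ _)) (linear_sum (tmap _ _)) /=; apply: eq_bigr => al _.
rewrite (linear_sum (tmap _ _)) (linear_sum (tmap _ _)) /=; apply: eq_bigr => ga _.
rewrite (linearZ_LR (tmap _ _)) (linearZ_LR (tmap _ _)) /= tmap_sigma_tn.
by rewrite Phi0_sch tn_sumr scaler_sumr.
Qed.

(** * Independence of the irreducible character basis *)

Definition dlt (n : nat) (f : Sym) : Prop := forall m : Mon, (n <= wdeg m)%N -> f@_m = 0.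

Lemma dltD n f g : dlt n f -> dlt n g -> dlt n (f + g).
Proof. by move=> fn gn m mn; rewrite mcoeffD fn // gn // addr0. Qed.

(** The bounds are asymmetric because a weight below a and a weight at most b add up to less than a
    + b. *)
Lemma dltM a b f g : dlt a f -> dlt b.+1 g -> dlt (a + b) (f * g).
Proof.
move=> fa gb m abm; apply: mcoeff_outdom; apply/negP => /msuppM_le.
case=> [x [y [xf yg e]]]; move: xf yg; rewrite -!mcoeff_neq0 => xf yg.
have xa : (wdeg x < a)%N by rewrite ltnNge; apply: contra xf => /fa ->.
have yb : (wdeg y <= b)%N by rewrite -ltnS ltnNge; apply: contra yg => /gb ->.
by move: abm; rewrite e wdegM leqNgt -addSn leq_add.
Qed.

Lemma dltU m : dlt (wdeg m).+1 << m >>.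
Proof.
by move=> k; rewrite mcoeff_U; have [->|//] := eqVneq m k; rewrite ltnn.
Qed.

Lemma dlt_weaken n f : dlt n f -> dlt n.+1 f.
Proof. by move=> fn m mn; apply: fn; apply: ltnW. Qed.

Definition lead (f : Sym) (m : Mon) : Prop := dlt (wdeg m) (f - << m >>).

Lemma mulrBM (R : comNzRingType) (x y u v : R) :
  x * y - u * v = (x - u) * y + (y - v) * u.
Proof. by ring. Qed.

Lemma leadM f g m n : lead f m -> lead g n -> lead (f * g) (mmul m n).
Proof.
move=> fm gn; rewrite /lead wdegM malgU_mul.
rewrite mulrBM.
apply: dltD; last by rewrite addnC; exact: (dltM gn (@dltU m)).
apply: (dltM fm); rewrite -(subrK << n >> g).
exact: dltD (dlt_weaken gn) (@dltU n).
Qed.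

Lemma mob1 : mob 1 = 1.
Proof. by []. Qed.

Lemma mcoeff_nat (c : nat) (m : Mon) : (c%:R : Sym)@_m = (m == mone)%:R *+ c.
Proof. by rewrite (mcoeffMn m c 1) mcoeff1_Sym. Qed.

(** The divisor d = i+1 contributes p_(i+1) with coefficient [mob 1] = 1; the other divisors and the
    constant have smaller weight. *)
Lemma lead_qs i (c : nat) : lead (i.+1%:R *: qs i.+1 - c%:R) (ucm i).
Proof.
move=> m; rewrite wdegU => im.
have m1 : (m == mone) = false by apply/eqP => e; rewrite e wdeg1 in im.
rewrite (mcoeffB m (i.+1%:R *: qs i.+1 - c%:R)) (mcoeffB m (i.+1%:R *: qs i.+1)).
rewrite mcoeff_nat m1 mul0rn subr0.
have i0 : i.+1%:R != 0 :> rat by rewrite Num.Theory.pnatr_eq0.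
rewrite (qsE i.+1) scalerA (mulfV i0) scale1r raddf_sum /=.
rewrite (bigD1_seq i.+1) ?divisors_uniq ?divisors_id //= divnn mob1 scale1r.
rewrite ps_U big_seq_cond big1 ?addr0 ?subrr // => d /andP[].
rewrite -dvdn_divisors // => di ne; rewrite mcoeffZ.
case: d di ne => [|d] di ne; first by rewrite dvd0n in di.
rewrite ps_U mcoeff_U; case: eqP => [e|_]; last by rewrite mulr0.
move: im; rewrite -e wdegU leqNgt => /negP[].
by rewrite ltn_neqAle ne dvdn_leq.
Qed.

Lemma scale_falling_step (A : comAlgType rat) (q x : A) (i r c : nat) :
  (i * c)%:R *: (x * (q - r%:R)) = (i%:R *: q - (i * r)%:R) * (c%:R *: x).
Proof. by rewrite -!natr_scale !natrM; ring. Qed.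

(** Spreading i^r over the factors of the falling factorial gives each of them the form treated in
    [lead_qs], so leading terms multiply. *)
Lemma pbS i r : pb i r.+1 = (i%:R *: qs i - (i * r)%N%:R) * pb i r.
Proof. by rewrite !pbE fallingS expnS scale_falling_step. Qed.

Lemma Phi0_mon_ucmM i (m : Mon) : Phi0_mon (mmul (ucm i) m) =
  (i.+1%:R *: qs i.+1 - (i.+1 * m i)%N%:R) * Phi0_mon m.
Proof.
have [N mN] := supp_bound (mmul (ucm i) m).
have iN : (i < N)%N by apply: mN; rewrite cmM cmUU.
have mN' j : m j != 0%N -> (j < N)%N.
  by move=> mj; apply: mN; rewrite cmM addn_eq0 negb_and mj orbT.
rewrite (Phi0_monE mN) (Phi0_monE mN').
exact: (prod_ucmM (F := fun j => pb j.+1) iN (pbS i.+1 (m i))).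
Qed.

Lemma mcoeff_lead f m k : lead f m -> (wdeg m <= wdeg k)%N -> f@_k = << m >>@_k.
Proof. by move=> fm mk; apply/eqP; rewrite -subr_eq0 -mcoeffB fm. Qed.

Lemma lead_Phi0_mon m : lead (Phi0_mon m) m.
Proof.
elim/Mon_ind: m => [|i m IHm].
  rewrite (_ : Phi0_mon mone = << mone >>); last by rewrite /Phi0_mon mdom1 big_seq_fset0.
  by move=> k _; rewrite subrr mcoeff0.
by rewrite Phi0_mon_ucmM; apply: leadM => //; apply: lead_qs.
Qed.

Lemma mcoeffZ_congr (f g : Sym) m c : f@_m = g@_m -> (c *: f)@_m = (c *: g)@_m.
Proof.
move=> fg; apply: etrans (mcoeffZ c f m) _; rewrite fg.
exact: esym (mcoeffZ c g m).
Qed.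

(** By [lead_Phi0_mon], f and [Phi0 f] have the same coefficients in the top weight of f. So a bound
    on the weights of f can be lowered repeatedly, down to 0. *)
Lemma Phi0_eq0 f : Phi0 f = 0 -> f = 0.
Proof.
move=> f0; have step n : dlt n.+1 f -> dlt n f.
  move=> fn m; rewrite leq_eqVlt => /predU1P[nm|/fn //].
  transitivity ((Phi0 f)@_m); last by rewrite f0 mcoeff0.
  rewrite /Phi0 linextE [LHS](_ : _ = (\sum_(k <- msupp f) f@_k *: << k >>)@_m).
    rewrite [LHS]raddf_sum [RHS]raddf_sum /= [LHS]big_seq [RHS]big_seq.
    apply: eq_bigr => k kf.
    apply: mcoeffZ_congr; apply/esym/(mcoeff_lead (@lead_Phi0_mon k)).
    rewrite -nm -ltnS ltnNge.
    by move: kf; rewrite -mcoeff_neq0; apply: contra => /fn ->.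
  by rewrite -malg_scaleE.
have all n : dlt n f -> dlt 0 f by elim: n => // n IHn /step.
apply/malgP => m; rewrite mcoeff0.
apply: (all (\max_(k <- msupp f) wdeg k).+1) => // k kn.
apply: mcoeff_outdom; apply: contraL kn => kf; rewrite -ltnNge ltnS.
exact: leq_bigmax_seq.
Qed.

Definition schcomb : {malg rat[intpartn]} -> Sym := linext sch.

(** [Phi0] and [sigma] are injective, and pairing with s_a reads off the coefficient of X at a. *)
Lemma schcomb_eq0 X : Phi (schcomb X) = 0 -> X = 0.
Proof.
move=> /Phi0_eq0 sX; have X0 : schcomb X = 0.
  by rewrite -(sigmaK (schcomb X)) sX (linear0 tau).
apply/malgP => a; rewrite mcoeff0.
transitivity (hl (sch a) (schcomb X)); last by rewrite X0 (linear0 (hl (sch a))).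
rewrite /schcomb linextE hl_sumr [LHS](_ : _ = (\sum_(k <- msupp X) X@_k *: << k >>)@_a).
  rewrite raddf_sum /=; apply: eq_bigr => k _.
  by rewrite hlZr hl_sch mcoeffZ mcoeffU eq_sym.
by rewrite -malg_scaleE.
Qed.

Definition stilcomb : coefs2 -> Sym2 :=
  linext (fun ab : (intpartn * intpartn)%type => tn (Phi (sch ab.1)) (Phi (sch ab.2))).

Lemma stil2_combE C : stil2_comb C = stilcomb C.
Proof.
rewrite /stil2_comb /stilcomb linextE; apply: eq_bigr => ab _.
by rewrite tn_tens !stil_Phi.
Qed.

Lemma stilcomb_is_linear : linear stilcomb.
Proof. exact: linext_is_linear. Qed.

HB.instance Definition _ :=
  GRing.isLinear.Build rat coefs2 Sym2 *:%R stilcomb stilcomb_is_linear.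

Lemma stilcombU ab : stilcomb << ab >> = tn (Phi (sch ab.1)) (Phi (sch ab.2)).
Proof. exact: linextU. Qed.

(* The coefficients of an expansion are recovered in two steps, with one tensor
   factor at a time. *)
Lemma stilcomb_eq0 C : stilcomb C = 0 -> C = 0.
Proof.
move=> C0.
(* [row n] collects what stands to the left of the monomial n of the second factor; [col a] collects
   the coefficients with first index a. The vanishing of every [row n] makes the image of [col a]
   under [Phi] vanish at every n. *)
pose row n : {malg rat[intpartn]} := \sum_(ab <- msupp C)
  (C@_ab * (Phi (sch ab.2))@_n) *: << ab.1 >>.
pose col a : {malg rat[intpartn]} := \sum_(ab <- msupp C)
  (C@_ab * (ab.1 == a)%:R) *: << ab.2 >>.
have Phicomb (I : Type) (r : seq I) (c : I -> rat) (p : I -> intpartn) :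
    Phi (schcomb (\sum_(i <- r) c i *: << p i >>)) = \sum_(i <- r) c i *: Phi (sch (p i)).
  rewrite /schcomb (linear_sum (linext sch)) (linear_sum Phi); apply: eq_bigr => i _ /=.
  by rewrite (linearZ_LR (linext sch)) /= linextU (linearZ_LR Phi).
have row0 n : row n = 0.
  apply: schcomb_eq0; rewrite Phicomb; apply/malgP => m; rewrite mcoeff0.
  transitivity ((stilcomb C)@_(m, n)); last by rewrite C0 mcoeff0.
  rewrite /stilcomb linextE !raddf_sum /=; apply: eq_bigr => ab _.
  by rewrite !mcoeffZ tnE -mulrA; congr (_ * _); apply: mulrC.
have col0 a : col a = 0.
  apply: schcomb_eq0; rewrite Phicomb; apply/malgP => n; rewrite mcoeff0.
  transitivity ((row n)@_a); last by rewrite row0 mcoeff0.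
  rewrite /row !raddf_sum /=; apply: eq_bigr => ab _.
  by rewrite !mcoeffZ mcoeffU mulrAC.
apply/malgP => -[a b]; rewrite mcoeff0.
transitivity ((col a)@_b); last by rewrite col0 mcoeff0.
rewrite [C in LHS](malg_scaleE C) /col !raddf_sum /=; apply: eq_bigr => -[a' b'] _.
rewrite !mcoeffZ !mcoeffU xpair_eqE -mulrA; congr (_ * _) => /=.
by case: (a' == a); case: (b' == b); rewrite ?mulr1 ?mul0r ?mulr0.
Qed.

(** * Coefficients of the expansion *)

Definition stil_coefs (la : intpartn) : coefs2 :=
  \sum_(al <- intpartns_le (psize la))
    \sum_(ga <- intpartns (psize la - psize al))
      \sum_(be <- intpartns_le (psize ga) | hstrip ga be)
        hl (sch al * sch ga) (sch la) *: << (al, be) >>.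

Lemma stilcomb_coefs la : stilcomb (stil_coefs la) = delta (Phi (sch la)).
Proof.
rewrite delta_Phi_sch /stil_coefs (linear_sum stilcomb); apply: eq_bigr => al _ /=.
rewrite (linear_sum stilcomb); apply: eq_bigr => ga _ /=.
rewrite (linear_sum stilcomb); apply: eq_bigr => be _ /=.
by rewrite (linearZ_LR stilcomb) /= stilcombU.
Qed.

Lemma mcoeff_stil_coefs la al be : (stil_coefs la)@_(al, be) =
  \sum_(ga <- intpartns_le (psize la) | hstrip ga be && (psize ga + psize al == psize la)%N)
     hl (sch al * sch ga) (sch la).
Proof.
pose c x ga : rat := if hstrip ga be then hl (sch x * sch ga) (sch la) else 0.
have inner x ga :
    (\sum_(b <- intpartns_le (psize ga) | hstrip ga b)
        hl (sch x * sch ga) (sch la) *: << (x, b) >> : coefs2)@_(al, be) =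
    (x == al)%:R * c x ga.
  rewrite raddf_sum /= (eq_bigr (fun b => hl (sch x * sch ga) (sch la) *
    ((x == al) && (b == be))%:R)); last first.
    by move=> b _; rewrite mcoeffZ mcoeffU xpair_eqE.
  rewrite /c; have [gb|gb] := boolP (hstrip ga be); last first.
    rewrite mulr0 big1 // => b bs; case: (b =P be) => [e|_].
      by rewrite e (negPf gb) in bs.
    by rewrite andbF mulr0.
  rewrite -big_filter (bigD1_seq be) /=; first last.
  - exact/filter_uniq/uniq_intpartns_le.
  - by rewrite mem_filter gb mem_intpartns_le hstrip_psize.
  rewrite eqxx andbT big1 ?addr0 1?mulrC // => b /negPf ->.
  by rewrite andbF mulr0.
rewrite /stil_coefs raddf_sum /= (eq_bigr (fun x =>
  (x == al)%:R * \sum_(ga <- intpartns (psize la - psize x)) c x ga)); last first.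
  move=> x _; rewrite raddf_sum mulr_sumr; apply: eq_bigr => ga _.
  exact: inner.
rewrite [RHS]big_mkcond [RHS](eq_bigr (fun ga =>
  if (psize ga + psize al == psize la)%N then c al ga else 0)); last first.
  by move=> ga _; rewrite /c; case: (hstrip ga be); case: eqP.
(* If |al| > |la|, then al is not in the range on the left and no ga meets the size condition on the
   right. *)
have [alN|alN] := leqP (psize al) (psize la); last first.
  rewrite [LHS]big_seq [LHS]big1 => [|x]; last first.
    rewrite mem_intpartns_le; case: eqP => [->|_ _]; last by rewrite mul0r.
    by rewrite leqNgt alN.
  rewrite [RHS]big1 // => ga _; case: eqP => // e.
  by move: alN; rewrite -e ltnNge leq_addl.
rewrite (bigD1_seq al) /=; first last.
- exact: uniq_intpartns_le.
- by rewrite mem_intpartns_le.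
rewrite eqxx mul1r [X in _ + X]big1 ?addr0 => [|x /negPf ->]; last by rewrite mul0r.
rewrite [RHS](@big_intpartns_le _ _ (psize la - psize al)) ?leq_subr //; last first.
  by move=> ga ne; case: eqP => // e; rewrite -e addnK eqxx in ne.
rewrite big_seq [RHS]big_seq; apply: eq_bigr => ga; rewrite mem_intpartns => /eqP ->.
by rewrite subnK // eqxx.
Qed.

Theorem mainTheorem11 (la : intpartn) :
  Delta (stil la) =
    \sum_(al <- intpartns_le (psize la))
      \sum_(ga <- intpartns (psize la - psize al))
        \sum_(be <- intpartns_le (psize ga) | hstrip ga be)
          LRcoef la al ga *: (stil al ⊗ stil be)
  /\
  (forall al be : intpartn,
     stil2_coef_is (Delta (stil la)) al be
       (\sum_(ga <- intpartns_le (psize la)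
               | hstrip ga be &&
                 ((psize ga)%:Z - (psize be)%:Z ==
                    (psize la)%:Z - (psize al)%:Z - (psize be)%:Z))
          LRcoef la al ga)).
Proof.
rewrite Delta_delta stil_Phi; split.
  rewrite delta_Phi_sch; apply: eq_bigr => al _; apply: eq_bigr => ga _.
  by apply: eq_bigr => be _; rewrite LRcoefE tn_tens !stil_Phi.
move=> al be; split; first by exists (stil_coefs la); rewrite stil2_combE stilcomb_coefs.
move=> C; rewrite stil2_combE -stilcomb_coefs => eC.
(* Any other expansion has the same coefficients by independence of the products \tilde s_al ⊗
   \tilde s_be. *)
have -> : C = stil_coefs la.
  apply/eqP; rewrite -subr_eq0; apply/eqP/stilcomb_eq0.
  by rewrite (linearB stilcomb) /= eC subrr.
rewrite mcoeff_stil_coefs; apply: eq_big => [ga|ga _]; last by rewrite LRcoefE.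
(* Cancelling |be| in the integer equation leaves |ga| + |al| = |la|. *)
by congr (_ && _); rewrite (inj_eq (addIr _)) [RHS]eq_sym subr_eq -PoszD eqz_nat eq_sym.
Qed.
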